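(* Let $G$ be a localic group. There is an isomorphism of categories $Cmd_0(G)\cong\mathcal{R}el(\beta^G)$ commuting with the forgetful functors $T:Cmd_0(G)\to Sup_0=\mathcal{R}el$ and $\mathcal{R}el(F):\mathcal{R}el(\beta^G)\to\mathcal{R}el$, where $F:\beta^G\to\mathcal{E}ns$ is the functor forgetting the action. That is, the identification between relations $R\subset X\times X'$ and linear maps $\ell X\to\ell X'$ lifts to an identification between the arrows of $\mathcal{R}el(\beta^G)$ and the arrows of $Cmd_0(G)$.
   Context: $\mathcal{E}ns$ is the category of sets. $Sup$ is the monoidal category of sup-lattices (posets with arbitrary suprema) and linear (supremum-preserving) maps; $S\otimes S'$ is the codomain of the universal bilinear map, with unit $2=\{0\le 1\}$. A locale is a sup-lattice where finite infima distribute over arbitrary suprema; locale morphisms are linear maps preserving $\wedge$ and $1$; the coproduct of locales is $\otimes$. A localic group $G$ is a group object in the opposite of the category of locales, i.e. a locale $G$ with locale morphisms $w:G\to G\otimes G$ (comultiplication), $e:G\to 2$ (counit), $\iota:G\to G$ (antipode) satisfying the dual group axioms. $\ell X$ denotes the power set of a set $X$, the free sup-lattice on $X$; $\ell X\otimes\ell Y=\ell(X\times Y)$. Linear maps $\ell X\to\ell Y$ are the same as relations $R\subset X\times Y$, so $\mathcal{R}el$ (sets and relations) is identified with the full subcategory $Sup_0\subset Sup$ of objects $\ell X$. $Cmd_0(G)$ is the category whose objects are the left $G$-comodules in $Sup$ of the form $\rho:\ell X\to G\otimes\ell X$, $X$ a set (so $(G\otimes\rho)\rho=(w\otimes\ell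 X)\rho$ and $(e\otimes\ell X)\rho$ is the canonical isomorphism $\ell X\cong 2\otimes\ell X$), and whose arrows are all comodule morphisms; $T$ forgets the coaction. A function $\lambda:X\times Y\to G$ is an $\ell$-bijection if: (ed) $\bigvee_y\lambda\langle a,y\rangle=1$ for all $a$; (uv) $\lambda\langle x,b_1\rangle\wedge\lambda\langle x,b_2\rangle=0$ for all $x$, $b_1\ne b_2$; (su) $\bigvee_x\lambda\langle x,b\rangle=1$ for all $b$; (in) $\lambda\langle a_1,y\rangle\wedge\lambda\langle a_2,y\rangle=0$ for all $y$, $a_1\neq a_2$. A $G$-set is a set $X$ with an action: an $\ell$-bijection $\mu:X\times X\to G$ with $w\mu\langle a|b\rangle=\bigvee_{x}\mu\langle a|x\rangle\otimes\mu\langle x|b\rangle$, $e\mu\langle a|b\rangle=\delta_{a=b}$ (that is, $1$ if $a=b$, $0$ otherwise), $\iota\mu\langle a|b\rangle=\mu\langle b|a\rangle$. A morphism of $G$-sets $(X,\mu)\to(X',\mu')$ is a function $f$ with $\mu\langle a|b\rangle\le\mu'\langle f(a)|f(b)\rangle$. $\beta^G$ is the category of $G$-sets; it is a topos, and $F$ is the inverse image of a point. $\mathcal{R}el(\beta^G)$ has $G$-sets as objects and relations (subobjects) $R\hookrightarrow X\times X'$ in $\beta^G$ as arrows $X\to X'$; $\mathcal{R}el(F)$ sends such a relation to the underlying relation of sets. *)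

(* Defs.v *)
From HB Require Import structures.
From mathcomp Require Import all_boot all_order.
From mathcomp Require Import boolp classical_sets.

Set Implicit Arguments.
Unset Strict Implicit.
Unset Printing Implicit Defensive.

Import Order.TTheory.
Local Open Scope classical_set_scope.
Local Open Scope order_scope.

HB.mixin Record POrder_hasSup d T of Order.POrder d T := {
  ssup : set T -> T;
  ssupP : forall (A : set T) (x : T), (ssup A <= x) <-> ubound A x
}.

#[short(type="supLatticeType")]
HB.structure Definition SupLattice d :=
  {T of POrder_hasSup d T & Order.POrder d T}.

Section SupLatticeTheory.
Context {d : Order.disp_t} {S : supLatticeType d}.
Implicit Types (A B : set S) (x y : S).

Lemma ssup_ub A x : A x -> x <= ssup A.
Proof. by move=> Ax; have /ssupP := lexx (ssup A); apply. Qed.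

Lemma ssup_le A x : (forall a, A a -> a <= x) -> ssup A <= x.
Proof. by move=> h; apply/ssupP. Qed.

Lemma le_ssup A B : A `<=` B -> ssup A <= ssup B.
Proof. by move=> AB; apply: ssup_le => a /AB; exact: ssup_ub. Qed.

Lemma ssup_eq A x : (forall a, A a -> a <= x) ->
  (forall y, (forall a, A a -> a <= y) -> x <= y) -> ssup A = x.
Proof.
move=> h1 h2; apply/le_anti; rewrite ssup_le//=.
by apply: h2 => a; exact: ssup_ub.
Qed.

Lemma ssup1 x : ssup [set x] = x.
Proof. by apply: ssup_eq => [a ->//|y]; apply. Qed.

Lemma ssup2 x y : x <= y -> ssup [set x; y] = y.
Proof. by move=> xy; apply: ssup_eq => [a [->|->]//|z]; apply; right. Qed.

Lemma ssup_bigcup I (D : set I) (F : I -> set S) :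
  ssup (\bigcup_(i in D) F i) = ssup [set ssup (F i) | i in D].
Proof.
apply: ssup_eq => [a [i Di Fa]|y h].
  by apply: le_trans (ssup_ub Fa) _; apply: ssup_ub; exists i.
apply: ssup_le => _ [i Di <-]; apply: ssup_le => a Fa.
by apply: h; exists i.
Qed.

End SupLatticeTheory.

Definition is_linear {d d'} {S : supLatticeType d} {T : supLatticeType d'}
  (f : S -> T) := forall A : set S, f (ssup A) = ssup (f @` A).

Record linear {d d'} (S : supLatticeType d) (T : supLatticeType d') := Linear {
  linear_fun :> S -> T;
  linearP : is_linear linear_fun
}.

Section Linear.
Context {d d' d'' : Order.disp_t}.
Context {S : supLatticeType d} {T : supLatticeType d'} {U : supLatticeType d''}.

Lemma linear_eq (f g : linear S T) : f =1 g -> f = g.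
Proof.
case: f g => [f fP] [g gP] /= /funext fg; subst g.
by congr Linear; exact: Prop_irrelevance.
Qed.

Lemma is_linear_le (f : S -> T) : is_linear f -> {homo f : x y / x <= y}.
Proof.
by move=> fl x y xy; rewrite -(ssup2 xy) fl; apply: ssup_ub; exists x => //; left.
Qed.

Lemma is_linear_id : is_linear (@id S).
Proof. by move=> A; rewrite image_id. Qed.

Lemma is_linear_comp (g : T -> U) (f : S -> T) :
  is_linear g -> is_linear f -> is_linear (g \o f).
Proof. by move=> gl fl A; rewrite /= fl gl image_comp. Qed.

Definition linear_id := Linear is_linear_id.

Definition linear_comp (g : linear T U) (f : linear S T) :=
  Linear (is_linear_comp (linearP g) (linearP f)).

End Linear.
Arguments linear_id {d} S.

Lemma linear_comp1 {d d'} {S : supLatticeType d} {T : supLatticeType d'}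
  (f : linear S T) : linear_comp f (linear_id S) = f.
Proof. exact: linear_eq. Qed.

Lemma linear_1comp {d d'} {S : supLatticeType d} {T : supLatticeType d'}
  (f : linear S T) : linear_comp (linear_id T) f = f.
Proof. exact: linear_eq. Qed.

Lemma linear_compA {d1 d2 d3 d4} {S : supLatticeType d1} {T : supLatticeType d2}
    {U : supLatticeType d3} {V : supLatticeType d4}
    (h : linear U V) (g : linear T U) (f : linear S T) :
  linear_comp h (linear_comp g f) = linear_comp (linear_comp h g) f.
Proof. exact: linear_eq. Qed.

Lemma bool_ssupP (A : set bool) (x : bool) : (`[< A true >] <= x) <-> ubound A x.
Proof.
split=> [h a Aa|h].
  by case: a Aa => // At; move: h; rewrite asboolT.
by case: asboolP => // At; exact: h.
Qed.

HB.instance Definition _ := @POrder_hasSup.Build _ bool _ bool_ssupP.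

Lemma set_ssupP X (A : set (set X)) (B : set X) :
  (\bigcup_(C in A) C <= B) <-> ubound A B.
Proof.
rewrite subsetEset; split=> [h C AC|h x [C AC Cx]].
  by rewrite subsetEset => x Cx; apply: h; exists C.
by have := h _ AC; rewrite subsetEset; apply.
Qed.

HB.instance Definition _ (X : Type) :=
  @POrder_hasSup.Build _ (set X) _ (@set_ssupP X).

(* A subset of [S * T] is a bi-ideal when its indicator function is a bilinear
   map into the opposite of [2]; in particular it is then downward closed.
   The bi-ideals, ordered by inclusion, form the tensor product: see
   [pure_bilinear], [tlift_is_linear], [tlift_pure] and [tensor_ext] for its
   universal property. *)
Definition bi_ideal {d d'} {S : supLatticeType d} {T : supLatticeType d'}
    (U : set (S * T)) :=
  (forall (A : set S) t, U (ssup A, t) <-> (forall s, A s -> U (s, t))) /\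
  (forall s (B : set T), U (s, ssup B) <-> (forall t, B t -> U (s, t))).

Record tensor {d d'} (S : supLatticeType d) (T : supLatticeType d') := Tensor {
  tset :> set (S * T);
  tensorP : bi_ideal tset
}.

Fact tensor_display : Order.disp_t. Proof. exact: (Order.Disp tt tt). Qed.

Section TensorOrder.
Context {d d' : Order.disp_t} {S : supLatticeType d} {T : supLatticeType d'}.

HB.instance Definition _ := gen_eqMixin (tensor S T).
HB.instance Definition _ := gen_choiceMixin (tensor S T).

Lemma tensor_eq (U V : tensor S T) : tset U = tset V -> U = V.
Proof.
case: U V => [U UP] [V VP] /= UV; subst V.
by congr Tensor; exact: Prop_irrelevance.
Qed.

Definition tensor_le (U V : tensor S T) : bool :=
  (tset U <= tset V)%O.

Lemma tensor_le_refl : reflexive tensor_le.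
Proof. by move=> U; exact: lexx. Qed.
Lemma tensor_le_anti : antisymmetric tensor_le.
Proof. by move=> U V /le_anti; exact: tensor_eq. Qed.
Lemma tensor_le_trans : transitive tensor_le.
Proof. by move=> V U W; exact: le_trans. Qed.

HB.instance Definition _ := Order.Le_isPOrder.Build tensor_display (tensor S T)
  tensor_le_refl tensor_le_anti tensor_le_trans.

Lemma tensor_leP (U V : tensor S T) : (U <= V) <-> (U `<=` V).
Proof. by rewrite -subsetEset. Qed.

Lemma bi_ideal_bigcap I (D : set I) (F : I -> set (S * T)) :
  (forall i, D i -> bi_ideal (F i)) -> bi_ideal (\bigcap_(i in D) F i).
Proof.
move=> DF; split=> [A t|s B]; split=> h.
- by move=> s As i Di; apply: (((DF i Di).1 A t).1 (h i Di)).
- by move=> i Di; apply/((DF i Di).1 A t) => s As; exact: h.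
- by move=> t Bt i Di; apply: (((DF i Di).2 s B).1 (h i Di)).
- by move=> i Di; apply/((DF i Di).2 s B) => t Bt; exact: h.
Qed.

Definition bi_closure (P : set (S * T)) : tensor S T :=
  @Tensor _ _ S T (\bigcap_(U in [set U | bi_ideal U /\ P `<=` U]) U)
    (bi_ideal_bigcap (fun U (h : bi_ideal U /\ P `<=` U) => h.1)).

Lemma bi_closure_sub P : P `<=` bi_closure P.
Proof. by move=> p Pp U [_]; apply. Qed.

Lemma bi_closure_min (P U : set (S * T)) :
  bi_ideal U -> P `<=` U -> bi_closure P `<=` U.
Proof. by move=> UP PU p; apply. Qed.

Definition tensor_ssup (A : set (tensor S T)) : tensor S T :=
  bi_closure (\bigcup_(U in A) tset U).

Lemma tensor_ssupP (A : set (tensor S T)) (U : tensor S T) :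
  (tensor_ssup A <= U) <-> ubound A U.
Proof.
rewrite tensor_leP; split=> [h V AV|h].
  rewrite tensor_leP => p Vp; apply: h.
  by apply: bi_closure_sub; exists V.
apply: bi_closure_min (tensorP U) _ => p [V AV Vp].
by have /tensor_leP := h _ AV; apply.
Qed.

HB.instance Definition _ := @POrder_hasSup.Build _ (tensor S T) _ tensor_ssupP.

End TensorOrder.

Definition pure {d d'} {S : supLatticeType d} {T : supLatticeType d'}
  (s : S) (t : T) : tensor S T := bi_closure [set (s, t)].
Notation "s ⊗ t" := (pure s t) (at level 40, left associativity).

Definition bilinear {d d' d''} {S : supLatticeType d} {T : supLatticeType d'}
    {U : supLatticeType d''} (f : S -> T -> U) :=
  (forall t, is_linear (f^~ t)) /\ (forall s, is_linear (f s)).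

Definition tlift {d d' d''} {S : supLatticeType d} {T : supLatticeType d'}
    {U : supLatticeType d''} (f : S -> T -> U) (W : tensor S T) : U :=
  ssup [set f p.1 p.2 | p in W].

Section TensorTheory.
Context {d d' d'' : Order.disp_t}.
Context {S : supLatticeType d} {T : supLatticeType d'} {V : supLatticeType d''}.

Lemma tensor_down (U : tensor S T) s s' t t' :
  s <= s' -> t <= t' -> tset U (s', t') -> tset U (s, t).
Proof.
move=> ss tt; rewrite -(ssup2 ss) -(ssup2 tt).
move/((tensorP U).1 _ _) => /(_ s (or_introl erefl)).
by move/((tensorP U).2 _ _) => /(_ t (or_introl erefl)).
Qed.

Lemma pure_leP (U : tensor S T) s t : (s ⊗ t <= U) <-> tset U (s, t).
Proof.
rewrite tensor_leP; split=> [|Ust]; first by apply; exact: bi_closure_sub.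
by apply: bi_closure_min (tensorP U) _ => _ ->.
Qed.

Lemma tensor_ssup_pure (U : tensor S T) :
  U = ssup [set p.1 ⊗ p.2 | p in tset U].
Proof.
apply/esym/ssup_eq => [_ [[s t] Ust <-]|W h]; first by apply/pure_leP.
by apply/tensor_leP => -[s t] Ust; apply/pure_leP; apply: h; exists (s, t).
Qed.

Lemma pure_bilinear : bilinear (@pure _ _ S T).
Proof.
split=> [t A|s B]; apply/esym/ssup_eq.
- by move=> _ [s As <-]; apply/pure_leP; apply: tensor_down (ssup_ub As) (lexx t) _;
    exact/pure_leP.
- move=> U h; apply/pure_leP/(tensorP U).1 => s As; apply/pure_leP.
  by apply: h; exists s.
- by move=> _ [t Bt <-]; apply/pure_leP; apply: tensor_down (lexx s) (ssup_ub Bt) _;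
    exact/pure_leP.
- move=> U h; apply/pure_leP/(tensorP U).2 => t Bt; apply/pure_leP.
  by apply: h; exists t.
Qed.

Lemma tlift_leP (f : S -> T -> V) (W : tensor S T) v :
  (tlift f W <= v) <-> (forall s t, tset W (s, t) -> f s t <= v).
Proof.
split=> [/ssupP h s t Wst|h]; first by apply: h; exists (s, t).
by apply: ssup_le => _ [[s t] Wst <-]; exact: h.
Qed.

Lemma bi_ideal_le (f : S -> T -> V) v : bilinear f ->
  bi_ideal [set p | f p.1 p.2 <= v].
Proof.
move=> [fl fr]; split=> [A t|s B] /=; rewrite ?fl ?fr.
  split=> [/ssupP h s As|h]; first by apply: h; exists s.
  by apply: ssup_le => _ [s As <-]; exact: h.
split=> [/ssupP h t Bt|h]; first by apply: h; exists t.
by apply: ssup_le => _ [t Bt <-]; exact: h.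
Qed.

Lemma tlift_is_linear (f : S -> T -> V) : bilinear f -> is_linear (tlift f).
Proof.
move=> fP A; apply/esym/ssup_eq => [_ [W AW <-]|v h].
  apply/tlift_leP => s t Wst; apply: ssup_ub; exists (s, t) => //.
  by have /tensor_leP := ssup_ub AW; apply.
apply/tlift_leP => s t; apply: (bi_closure_min (bi_ideal_le v fP)) => -[{}s {}t].
move=> [W AW Wst]; rewrite /mkset /=; have /tlift_leP := h _ (imageP _ AW).
exact.
Qed.

Lemma tlift_pure (f : S -> T -> V) s t : bilinear f -> tlift f (s ⊗ t) = f s t.
Proof.
move=> fP; apply/le_anti/andP; split.
  apply/tlift_leP => s' t'.
  by apply: (bi_closure_min (bi_ideal_le _ fP)) => _ -> /=.
have /tlift_leP := lexx (tlift f (s ⊗ t)); apply.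
exact: (@bi_closure_sub _ _ S T [set (s, t)]).
Qed.

Lemma tensor_ext (f g : tensor S T -> V) : is_linear f -> is_linear g ->
  (forall s t, f (s ⊗ t) = g (s ⊗ t)) -> f =1 g.
Proof.
move=> fl gl fg U; rewrite (tensor_ssup_pure U) fl gl !image_comp; congr ssup.
by apply: eq_imagel => p _ /=.
Qed.

Lemma pure_le (s s' : S) (t t' : T) : s <= s' -> t <= t' -> s ⊗ t <= s' ⊗ t'.
Proof. by move=> ss tt; apply/pure_leP/(tensor_down ss tt)/pure_leP. Qed.

End TensorTheory.

Section TensorMaps.
Context {d1 d2 d3 d4 : Order.disp_t}.
Context {S : supLatticeType d1} {T : supLatticeType d2}.

Lemma tmap_bilinear {S' : supLatticeType d3} {T' : supLatticeType d4}
    (f : linear S S') (g : linear T T') : bilinear (fun s t => f s ⊗ g t).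
Proof.
split=> [t A|s B]; rewrite linearP.
  by rewrite pure_bilinear.1 image_comp.
by rewrite pure_bilinear.2 image_comp.
Qed.

Definition tmap {S' : supLatticeType d3} {T' : supLatticeType d4}
    (f : linear S S') (g : linear T T') : linear (tensor S T) (tensor S' T') :=
  Linear (tlift_is_linear (tmap_bilinear f g)).

Lemma tassoc_bilinear (U : supLatticeType d3) :
  bilinear (fun (W : tensor S T) (u : U) => tlift (fun s t => s ⊗ (t ⊗ u)) W).
Proof.
have bl u : bilinear (fun (s : S) (t : T) => s ⊗ (t ⊗ u)).
  split=> [t|s] A; first by rewrite pure_bilinear.1.
  by rewrite pure_bilinear.1 pure_bilinear.2 image_comp.
split=> [u|W B]; first exact: tlift_is_linear.
apply/esym/ssup_eq => [_ [u Bu <-]|v h].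
  apply/tlift_leP => s t Wst; apply: le_trans (ssup_ub _); last by exists (s, t).
  by rewrite /= pure_le// pure_le// ssup_ub.
apply/tlift_leP => s t Wst; rewrite !pure_bilinear.2 image_comp.
apply: ssup_le => _ [u Bu <-] /=; apply: le_trans (h _ _); last by exists u.
by apply: ssup_ub; exists (s, t).
Qed.

Definition tassoc (U : supLatticeType d3) :
    linear (tensor (tensor S T) U) (tensor S (tensor T U)) :=
  Linear (tlift_is_linear (tassoc_bilinear U)).

End TensorMaps.

Lemma tmap_pure {d1 d2 d3 d4} {S : supLatticeType d1} {T : supLatticeType d2}
    {S' : supLatticeType d3} {T' : supLatticeType d4}
    (f : linear S S') (g : linear T T') s t :
  tmap f g (s ⊗ t) = f s ⊗ g t.
Proof. by rewrite /= tlift_pure//; exact: tmap_bilinear. Qed.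

Lemma tassoc_pure {d1 d2 d3} {S : supLatticeType d1} {T : supLatticeType d2}
    {U : supLatticeType d3} (s : S) (t : T) (u : U) :
  tassoc U ((s ⊗ t) ⊗ u) = s ⊗ (t ⊗ u).
Proof.
rewrite /= tlift_pure; last exact: tassoc_bilinear.
rewrite tlift_pure//; split=> [t'|s'] A; first by rewrite pure_bilinear.1.
by rewrite pure_bilinear.1 pure_bilinear.2 image_comp.
Qed.

Lemma tmap_id {d1 d2} {S : supLatticeType d1} {T : supLatticeType d2} :
  tmap (linear_id S) (linear_id T) =1 id.
Proof.
by apply: tensor_ext; [exact: linearP|exact: is_linear_id|move=> s t; rewrite tmap_pure].
Qed.

Lemma tmap_comp {d1 d2 d3 d4 d5 d6}
    {S : supLatticeType d1} {T : supLatticeType d2}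
    {S' : supLatticeType d3} {T' : supLatticeType d4}
    {S'' : supLatticeType d5} {T'' : supLatticeType d6}
    (f : linear S S') (g : linear T T')
    (f' : linear S' S'') (g' : linear T' T'') :
  tmap (linear_comp f' f) (linear_comp g' g) =1 tmap f' g' \o tmap f g.
Proof.
apply: tensor_ext; [exact: linearP| |].
  by apply: is_linear_comp; exact: linearP.
by move=> s t; rewrite [RHS]/comp !tmap_pure.
Qed.

HB.mixin Record isFrame d T of SupLattice d T & Order.TBMeetSemilattice d T := {
  meet_ssup : forall (x : T) (A : set T), x `&` ssup A = ssup [set x `&` a | a in A]
}.

#[short(type="localeType")]
HB.structure Definition Locale d :=
  {T of isFrame d T & SupLattice d T & Order.TBMeetSemilattice d T}.

Lemma bool_meet_ssup (x : bool) (A : set bool) :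
  x `&` ssup A = ssup [set x `&` a | a in A].
Proof.
apply/esym/ssup_eq => [_ [a Aa <-]|y h]; first exact: leI2 (lexx x) (ssup_ub Aa).
case: x h => h; last by rewrite meet0x le0x.
by rewrite meet1x; apply: ssup_le => a Aa; apply: h; exists a; rewrite ?meet1x.
Qed.

HB.instance Definition _ := isFrame.Build _ bool bool_meet_ssup.

Lemma set_meet_ssup X (x : set X) (A : set (set X)) :
  x `&` ssup A = ssup [set x `&` a | a in A].
Proof.
apply/esym/ssup_eq => [_ [a Aa <-]|y h]; first exact: leI2 (lexx x) (ssup_ub Aa).
rewrite subsetEset => z [xz [B AB Bz]].
have /h : [set (x `&` a)%O | a in A] (x `&` B)%O by exists B.
by rewrite subsetEset; apply.
Qed.

HB.instance Definition _ X := isFrame.Build _ (set X) (@set_meet_ssup X).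

Section TensorMeet.
Context {d d' : Order.disp_t} {S : supLatticeType d} {T : supLatticeType d'}.

Lemma bi_ideal_setI (U V : tensor S T) : bi_ideal (tset U `&` tset V)%classic.
Proof.
split=> [A t|s B]; split.
- by move=> [Uh Vh] s As; split; [apply: ((tensorP U).1 A t).1 As|
    apply: ((tensorP V).1 A t).1 As].
- by move=> h; split; [apply/((tensorP U).1 A t)|apply/((tensorP V).1 A t)] => s /h[].
- by move=> [Uh Vh] t Bt; split; [apply: ((tensorP U).2 s B).1 Bt|
    apply: ((tensorP V).2 s B).1 Bt].
- by move=> h; split; [apply/((tensorP U).2 s B)|apply/((tensorP V).2 s B)] => t /h[].
Qed.

Definition tensor_meet (U V : tensor S T) := Tensor (bi_ideal_setI U V).

Lemma tensor_lexI (U V W : tensor S T) :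
  (U <= tensor_meet V W) = (U <= V) && (U <= W).
Proof.
apply/idP/andP => [/tensor_leP h|[/tensor_leP UV /tensor_leP UW]].
  by split; apply/tensor_leP => p /h[].
by apply/tensor_leP => p Up; split; [exact: UV|exact: UW].
Qed.

Lemma bi_ideal_setT : bi_ideal [set: S * T]%classic. Proof. by []. Qed.

Lemma tensor_lex1 (U : tensor S T) : U <= Tensor bi_ideal_setT.
Proof. exact/tensor_leP. Qed.

Lemma tensor_le0x (U : tensor S T) : ssup set0 <= U.
Proof. exact: ssup_le. Qed.

HB.instance Definition _ := Order.POrder_isMeetSemilattice.Build
  tensor_display (tensor S T) tensor_lexI.
HB.instance Definition _ := Order.hasTop.Build
  tensor_display (tensor S T) tensor_lex1.
HB.instance Definition _ := Order.hasBottom.Build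
  tensor_display (tensor S T) tensor_le0x.

End TensorMeet.

Section LocaleTheory.
Context {d : Order.disp_t} {L : localeType d}.

Lemma ssup0 : ssup (@set0 L) = \bot.
Proof. by apply: ssup_eq => // y _; exact: le0x. Qed.

Lemma ssup_bot (A : set L) : (forall a, A a -> a = \bot) -> ssup A = \bot.
Proof. by move=> h; apply: ssup_eq => [a /h->//|y _]; exact: le0x. Qed.

Lemma ssup_meet (x : L) (A : set L) : ssup A `&` x = ssup [set a `&` x | a in A].
Proof.
by rewrite meetC meet_ssup; congr ssup; apply: eq_imagel => a _; rewrite meetC.
Qed.

End LocaleTheory.

Section TensorFrame.
Context {d d' : Order.disp_t} {L : localeType d} {M : localeType d'}.

Lemma tensor_meet_ssup (U : tensor L M) (A : set (tensor L M)) :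
  U `&` ssup A = ssup [set U `&` a | a in A].
Proof.
apply/esym/ssup_eq => [_ [V AV <-]|W h]; first exact: leI2 (lexx U) (ssup_ub AV).
pose I : set (L * M) := [set p | forall u v, tset U (u, v) ->
   tset W (p.1 `&` u, p.2 `&` v)].
have Iid : bi_ideal I.
  split=> [B t|s B]; split=> /=.
  - move=> IB s Bs u v /IB /=; apply: tensor_down => //.
    exact: leI2 (ssup_ub Bs) (lexx u).
  - move=> IB u v Uuv /=; rewrite ssup_meet.
    by apply/((tensorP W).1 _ _) => _ [s Bs <-]; exact: IB Uuv.
  - move=> IB t Bt u v /IB /=; apply: tensor_down => //.
    exact: leI2 (ssup_ub Bt) (lexx v).
  - move=> IB u v Uuv /=; rewrite ssup_meet.
    by apply/((tensorP W).2 _ _) => _ [t Bt <-]; exact: IB Uuv.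
apply/tensor_leP => -[s t] [Ust Ast].
suff AI : tset (ssup A) `<=` I by have := AI _ Ast _ _ Ust; rewrite /= !meetxx.
apply: (bi_closure_min Iid) => -[x y] [V AV Vxy] u v Uuv /=.
have /tensor_leP := h _ (imageP _ AV); apply; split.
  by apply: tensor_down Uuv; exact: leIr.
by apply: tensor_down Vxy; exact: leIl.
Qed.

HB.instance Definition _ :=
  isFrame.Build tensor_display (tensor L M) tensor_meet_ssup.

Lemma tensor_bot (U : tensor L M) s t : s = \bot \/ t = \bot -> tset U (s, t).
Proof.
by case=> ->; rewrite -ssup0; [apply/((tensorP U).1 _ _)|apply/((tensorP U).2 _ _)].
Qed.

Lemma in_pure (s : L) (t : M) x y : tset (s ⊗ t) (x, y) <->
  [\/ x = \bot, y = \bot | x <= s /\ y <= t].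
Proof.
split; last first.
  case=> [->|->|[xs yt]]; [by apply: tensor_bot; left|by apply: tensor_bot; right|].
  exact/pure_leP/pure_le.
pose I : set (L * M) := [set p | [\/ p.1 = \bot, p.2 = \bot | p.1 <= s /\ p.2 <= t]].
have Iid : bi_ideal I.
  split=> [A v|u B]; split; rewrite /I/mkset /=.
  - case=> [A0|->|[As vt]] u Au; [apply: Or31|exact: Or32|apply: Or33].
      by apply/le_anti; rewrite le0x -A0 ssup_ub.
    by split=> //; apply: le_trans As; exact: ssup_ub.
  - move=> h; have [->|v0] := eqVneq v \bot; first exact: Or32.
    have [vt|vt] := boolP (v <= t).
      apply: Or33; split=> //; apply: ssup_le => a /h[->|v0'|[]//]; first exact: le0x.
      by rewrite v0' eqxx in v0.
    apply: Or31; apply: ssup_bot => a /h[//|v0'|[_ vt']].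
      by rewrite v0' eqxx in v0.
    by rewrite vt' in vt.
  - case=> [->|B0|[us Bt]] v Bv; [exact: Or31|apply: Or32|apply: Or33].
      by apply/le_anti; rewrite le0x -B0 ssup_ub.
    by split=> //; apply: le_trans Bt; exact: ssup_ub.
  - move=> h; have [->|u0] := eqVneq u \bot; first exact: Or31.
    have [us|us] := boolP (u <= s).
      apply: Or33; split=> //; apply: ssup_le => a /h[u0'|->|[]//]; last exact: le0x.
      by rewrite u0' eqxx in u0.
    apply: Or32; apply: ssup_bot => a /h[u0'|//|[us' _]].
      by rewrite u0' eqxx in u0.
    by rewrite us' in us.
by apply: (bi_closure_min Iid) => _ -> /=; exact: Or33.
Qed.

Lemma pure_meet (s s' : L) (t t' : M) :
  (s ⊗ t) `&` (s' ⊗ t') = (s `&` s') ⊗ (t `&` t').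
Proof.
apply/le_anti/andP; split.
  apply/tensor_leP => -[x y] [/in_pure h /in_pure h']; apply/in_pure.
  case: h => [->|->|[xs yt]]; [exact: Or31|exact: Or32|].
  case: h' => [->|->|[xs' yt']]; [exact: Or31|exact: Or32|apply: Or33].
  by rewrite !lexI xs xs' yt yt'.
by rewrite lexI !pure_le// ?leIl ?leIr.
Qed.

End TensorFrame.

Record localeMor {d d'} (L : localeType d) (M : localeType d') := LocaleMor {
  localeMor_linear :> linear L M;
  localeMor_meet : {morph localeMor_linear : x y / x `&` y};
  localeMor_top : localeMor_linear \top = \top
}.

(* The locale morphism dual to the diagonal. *)
Definition codiagonal {d} {L : localeType d} : tensor L L -> L :=
  tlift (fun x y => x `&` y).

(* The unique locale morphism from the initial locale. *)
Definition initial_mor {d} (L : localeType d) (b : bool) : L :=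
  if b then \top else \bot.

Lemma codiagonal_pure {d} {L : localeType d} (x y : L) : codiagonal (x ⊗ y) = x `&` y.
Proof.
by apply: tlift_pure; split=> [z|z] A; [exact: ssup_meet|exact: meet_ssup].
Qed.

Record localicGroup d := LocalicGroup {
  localicGroup_locale :> localeType d;
  comul : localeMor localicGroup_locale
            (tensor localicGroup_locale localicGroup_locale);
  counit : localeMor localicGroup_locale bool;
  antipode : localeMor localicGroup_locale localicGroup_locale;
  comulA : forall x, tassoc _ (tmap comul (linear_id _) (comul x)) =
                     tmap (linear_id _) comul (comul x);
  counitl : forall x, tmap counit (linear_id _) (comul x) = true ⊗ x;
  counitr : forall x, tmap (linear_id _) counit (comul x) = x ⊗ true;
  antipodel : forall x, codiagonal (tmap antipode (linear_id _) (comul x)) =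
                        initial_mor _ (counit x);
  antipoder : forall x, codiagonal (tmap (linear_id _) antipode (comul x)) =
                        initial_mor _ (counit x)
}.

Record category := Category {
  ob :> Type;
  hom : ob -> ob -> Type;
  idm : forall a, hom a a;
  compm : forall a b c, hom b c -> hom a b -> hom a c;
  compm1 : forall a b (f : hom a b), compm f (idm a) = f;
  comp1m : forall a b (f : hom a b), compm (idm b) f = f;
  compmA : forall a b c e (h : hom c e) (g : hom b c) (f : hom a b),
    compm h (compm g f) = compm (compm h g) f
}.
Arguments idm {c} a : rename.
Notation "g ∘ f" := (compm g f) (at level 40, left associativity).

Record functor (C D : category) := Functor {
  fob :> C -> D;
  fhom : forall a b : C, hom a b -> hom (fob a) (fob b);
  fhom_id : forall a, fhom (idm a) = idm (fob a);
  fhom_comp : forall (a b c : C) (g : hom b c) (f : hom a b),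
    fhom (g ∘ f) = fhom g ∘ fhom f
}.

Definition functor_id (C : category) : functor C C :=
  @Functor C C id (fun _ _ => id) (fun _ => erefl) (fun _ _ _ _ _ => erefl).

Section FunctorComp.
Variables (C D E : category) (G : functor D E) (F : functor C D).

Let gfhom (a b : C) (f : hom a b) := fhom G (fhom F f).

Lemma functor_comp_id a : gfhom (idm a) = idm (G (F a)).
Proof. by rewrite /gfhom !fhom_id. Qed.

Lemma functor_comp_comp (a b c : C) (g : hom b c) (f : hom a b) :
  gfhom (g ∘ f) = gfhom g ∘ gfhom f.
Proof. by rewrite /gfhom !fhom_comp. Qed.

Definition functor_comp : functor C E :=
  @Functor C E (fun a => G (F a)) gfhom functor_comp_id functor_comp_comp.

End FunctorComp.

Definition isomorphism_of_categories (C D : category) (F : functor C D) :=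
  exists G : functor D C,
    functor_comp G F = functor_id C /\ functor_comp F G = functor_id D.

Definition mono (C : category) (a b : C) (m : hom a b) :=
  forall (c : C) (f g : hom c a), m ∘ f = m ∘ g -> f = g.

Record monoInto (C : category) (a : C) := MonoInto {
  mono_dom : C;
  mono_arr :> hom mono_dom a;
  mono_arrP : mono mono_arr
}.

Definition factors (C : category) (a b c : C) (f : hom a c) (g : hom b c) :=
  exists h : hom a b, g ∘ h = f.

Definition mono_equiv (C : category) (a : C) (m n : monoInto a) :=
  factors m n /\ factors n m.

Record subobject (C : category) (a : C) := Subobject {
  mono_class :> monoInto a -> Prop;
  mono_classP : exists m, mono_class = mono_equiv m
}.

Definition is_product (C : category) (a b p : C) (p1 : hom p a) (p2 : hom p b) :=
  forall (c : C) (f : hom c a) (g : hom c b),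
    exists! h : hom c p, p1 ∘ h = f /\ p2 ∘ h = g.

Definition is_pullback (C : category) (a b c w : C)
    (f : hom a c) (g : hom b c) (p : hom w a) (q : hom w b) :=
  f ∘ p = g ∘ q /\
  forall (z : C) (u : hom z a) (v : hom z b), f ∘ u = g ∘ v ->
    exists! h : hom z w, p ∘ h = u /\ q ∘ h = v.

(* The image of [h] is the least subobject through which [h] factors. *)
Definition is_image (C : category) (a b : C) (h : hom a b) (m : monoInto b) :=
  factors h m /\ forall n : monoInto b, factors h n -> factors m n.

(* Here [pij] are the projections of the product [x_ij] of [x_i] and [x_j];
   the composite of the relations [r] and [s] is the image in [x13] of the
   pullback of [r] and [s] over [x2]. *)
Definition is_composite (C : category) (x1 x2 x3 x12 x23 x13 : C)
    (p12_1 : hom x12 x1) (p12_2 : hom x12 x2)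
    (p23_2 : hom x23 x2) (p23_3 : hom x23 x3)
    (p13_1 : hom x13 x1) (p13_3 : hom x13 x3)
    (r : monoInto x12) (s : monoInto x23) (t : monoInto x13) :=
  exists (w : C) (p : hom w (mono_dom r)) (q : hom w (mono_dom s))
      (h : hom w x13),
    [/\ is_pullback (p12_2 ∘ r) (p23_2 ∘ s) p q,
        p13_1 ∘ h = p12_1 ∘ r ∘ p, p13_3 ∘ h = p23_3 ∘ s ∘ q
      & is_image h t].

Definition Ens : category :=
  @Category Type (fun X Y => X -> Y) (fun X => id) (fun X Y Z g f => g \o f)
    (fun _ _ _ => erefl) (fun _ _ _ => erefl) (fun _ _ _ _ _ _ _ => erefl).

Definition rel_comp X Y Z (S : set (Y * Z)) (R : set (X * Y)) : set (X * Z) :=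
  [set p | exists2 y, R (p.1, y) & S (y, p.2)].

Definition rel_id X : set (X * X) := [set p | p.1 = p.2].

Lemma rel_comp1 X Y (R : set (X * Y)) : rel_comp R (@rel_id X) = R.
Proof. by apply/seteqP; split=> -[x y] => [[z]|Rxy]; [rewrite /rel_id/= => ->|exists x]. Qed.

Lemma rel_1comp X Y (R : set (X * Y)) : rel_comp (@rel_id Y) R = R.
Proof. by apply/seteqP; split=> -[x y] => [[z Rz]|Rxy]; [rewrite /rel_id/= => <-|exists y]. Qed.

Lemma rel_compA W X Y Z (T : set (Y * Z)) (S : set (X * Y)) (R : set (W * X)) :
  rel_comp T (rel_comp S R) = rel_comp (rel_comp T S) R.
Proof.
apply/seteqP; split=> -[w z].
  by move=> [y [x Rx Sx] Ty]; exists x => //; exists y.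
by move=> [x Rx [y Sx Ty]]; exists y => //; exists x.
Qed.

Definition Rel : category :=
  @Category Type (fun X Y => set (X * Y)) rel_id rel_comp
    rel_comp1 rel_1comp rel_compA.

(* The full subcategory of sup-lattices and linear maps on the [set X]. *)
Definition Sup0 : category :=
  @Category Type (fun X Y => linear (set X) (set Y))
    (fun X => linear_id (set X)) (fun X Y Z g f => linear_comp g f)
    (fun _ _ => linear_comp1) (fun _ _ => linear_1comp)
    (fun _ _ _ _ => linear_compA).

Definition rel_image X Y (R : set (X * Y)) (A : set X) : set Y :=
  [set y | exists2 x, A x & R (x, y)].

Lemma rel_image_linear X Y (R : set (X * Y)) : is_linear (rel_image R).
Proof.
move=> A; apply/seteqP; split=> y.
  by move=> [x [B AB Bx] Rxy]; exists (rel_image R B); [exists B|exists x].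
by move=> [_ [B AB <-] [x Bx Rxy]]; exists x => //; exists B.
Qed.

Lemma rel_image_id X : Linear (rel_image_linear (@rel_id X)) = linear_id (set X).
Proof.
apply: linear_eq => A; apply/seteqP; split=> x; last by exists x.
by move=> [z Az]; rewrite /rel_id/= => <-.
Qed.

Lemma rel_image_comp X Y Z (S : set (Y * Z)) (R : set (X * Y)) :
  Linear (rel_image_linear (rel_comp S R)) =
  linear_comp (Linear (rel_image_linear S)) (Linear (rel_image_linear R)).
Proof.
apply: linear_eq => A; apply/seteqP; split=> z.
  by move=> [x Ax [y Rxy Syz]]; exists y => //; exists x.
by move=> [y [x Ax Rxy] Syz]; exists x => //; exists y.
Qed.

(* The identification [Rel = Sup0], an isomorphism by [ell_iso]. *)
Definition ell : functor Rel Sup0 :=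
  @Functor Rel Sup0 id (fun X Y R => Linear (rel_image_linear R))
    rel_image_id rel_image_comp.

Definition linear_rel X Y (f : linear (set X) (set Y)) : set (X * Y) :=
  [set p | f [set p.1] p.2].

Lemma linear_relK X Y : cancel (@linear_rel X Y) (fun R => Linear (rel_image_linear R)).
Proof.
move=> f; apply: linear_eq => A; have {2}-> : A = ssup [set [set x] | x in A].
  apply/seteqP; split=> x; first by move=> Ax; exists [set x] => //; exists x.
  by move=> [_ [{}x Ax <-] ->].
rewrite linearP; apply/seteqP; split=> y.
  by move=> [x Ax fxy]; exists (f [set x]) => //; exists [set x] => //; exists x.
by move=> [_ [_ [x Ax <-] <-] fxy]; exists x.
Qed.

Lemma rel_imageK X Y : cancel (fun R => Linear (rel_image_linear R)) (@linear_rel X Y).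
Proof.
move=> R; apply/seteqP; split=> -[x y]; first by move=> [_ /= ->].
by exists x.
Qed.

Lemma linear_rel_id X : linear_rel (linear_id (set X)) = @rel_id X.
Proof. by rewrite -rel_image_id rel_imageK. Qed.

Lemma linear_rel_comp X Y Z (g : linear (set Y) (set Z)) (f : linear (set X) (set Y)) :
  linear_rel (linear_comp g f) = rel_comp (linear_rel g) (linear_rel f).
Proof. by rewrite -{1}(linear_relK f) -{1}(linear_relK g) -rel_image_comp rel_imageK. Qed.

Definition ell_inv : functor Sup0 Rel :=
  @Functor Sup0 Rel id linear_rel linear_rel_id linear_rel_comp.

Lemma functor_eq_ob (C D : category) (F : C -> D) fh1 fh2 i1 i2 c1 c2 :
  (forall a b (f : hom a b), fh1 a b f = fh2 a b f) ->
  @Functor C D F fh1 i1 c1 = @Functor C D F fh2 i2 c2.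
Proof.
move=> h; have fhE : fh1 = fh2.
  by apply: functional_extensionality_dep => a; apply: functional_extensionality_dep => b;
     exact/funext.
by subst fh2; congr Functor; exact: Prop_irrelevance.
Qed.

Lemma ell_iso : isomorphism_of_categories ell.
Proof.
exists ell_inv; split; apply: functor_eq_ob => X Y f /=.
  exact: rel_imageK.
exact: linear_relK.
Qed.

Section Comodules.
Context {d : Order.disp_t} (G : localicGroup d).

Record comodule := Comodule {
  comodule_set : Type;
  coact : linear (set comodule_set) (tensor G (set comodule_set));
  coact_comul : forall A, tassoc _ (tmap (comul G) (linear_id _) (coact A)) =
                          tmap (linear_id G) coact (coact A);
  coact_counit : forall A, tmap (counit G) (linear_id _) (coact A) = true ⊗ A
}.

Record comoduleMor (M N : comodule) := ComoduleMor {
  comoduleMor_linear :> linear (set (comodule_set M)) (set (comodule_set N));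
  comoduleMorP : forall A, coact N (comoduleMor_linear A) =
                           tmap (linear_id G) comoduleMor_linear (coact M A)
}.

Lemma comoduleMor_eq M N (f g : comoduleMor M N) :
  comoduleMor_linear f = comoduleMor_linear g -> f = g.
Proof.
case: f g => [f fP] [g gP] /= fg; subst g.
by congr ComoduleMor; exact: Prop_irrelevance.
Qed.

Lemma comodule_idP M A : coact M (linear_id _ A) =
  tmap (linear_id G) (linear_id _) (coact M A).
Proof. by rewrite tmap_id. Qed.

Definition comodule_id M : comoduleMor M M := ComoduleMor (@comodule_idP M).

Lemma comodule_compP M N P (g : comoduleMor N P) (f : comoduleMor M N) A :
  coact P (linear_comp g f A) = tmap (linear_id G) (linear_comp g f) (coact M A).
Proof.
rewrite [linear_comp _ _ A]/= comoduleMorP comoduleMorP.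
have -> : linear_id G = linear_comp (linear_id G) (linear_id G).
  exact: linear_eq.
by rewrite tmap_comp /=.
Qed.

Definition comodule_comp M N P (g : comoduleMor N P) (f : comoduleMor M N) :=
  ComoduleMor (comodule_compP g f).

Lemma comodule_comp1 M N (f : comoduleMor M N) :
  comodule_comp f (comodule_id M) = f.
Proof. by apply: comoduleMor_eq; exact: linear_comp1. Qed.

Lemma comodule_1comp M N (f : comoduleMor M N) :
  comodule_comp (comodule_id N) f = f.
Proof. by apply: comoduleMor_eq; exact: linear_1comp. Qed.

Lemma comodule_compA M N P Q (h : comoduleMor P Q) (g : comoduleMor N P)
    (f : comoduleMor M N) :
  comodule_comp h (comodule_comp g f) = comodule_comp (comodule_comp h g) f.
Proof. by apply: comoduleMor_eq; exact: linear_compA. Qed.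

Definition Cmd0 : category :=
  @Category comodule comoduleMor comodule_id comodule_comp
    comodule_comp1 comodule_1comp comodule_compA.

Definition Cmd0_forget : functor Cmd0 Sup0 :=
  @Functor Cmd0 Sup0 comodule_set (fun M N f => comoduleMor_linear f)
    (fun _ => erefl) (fun _ _ _ _ _ => erefl).

End Comodules.

Record lbijection {d} {G : localeType d} X Y (lam : X -> Y -> G) : Prop :=
  LBijection {
    lbij_ed : forall a, ssup (range (lam a)) = \top;
    lbij_uv : forall x b1 b2, b1 <> b2 -> lam x b1 `&` lam x b2 = \bot;
    lbij_su : forall b, ssup (range (lam^~ b)) = \top;
    lbij_in : forall y a1 a2, a1 <> a2 -> lam a1 y `&` lam a2 y = \bot
  }.

Section GSets.
Context {d : Order.disp_t} (G : localicGroup d).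

Record gset := GSet {
  gset_sort :> Type;
  act : gset_sort -> gset_sort -> G;
  act_lbij : lbijection act;
  act_comul : forall a b,
    comul G (act a b) = ssup (range (fun x => act a x ⊗ act x b));
  act_counit : forall a b, counit G (act a b) = `[< a = b >];
  act_antipode : forall a b, antipode G (act a b) = act b a
}.

Record gsetMor (X Y : gset) := GSetMor {
  gsetMor_fun :> X -> Y;
  gsetMorP : forall a b, act a b <= act (gsetMor_fun a) (gsetMor_fun b)
}.

Lemma gsetMor_eq X Y (f g : gsetMor X Y) : f =1 g -> f = g.
Proof.
case: f g => [f fP] [g gP] /= /funext fg; subst g.
by congr GSetMor; exact: Prop_irrelevance.
Qed.

Definition gset_id X : gsetMor X X := @GSetMor X X id (fun a b => lexx (act a b)).

Definition gset_comp X Y Z (g : gsetMor Y Z) (f : gsetMor X Y) : gsetMor X Z :=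
  @GSetMor X Z (g \o f) (fun a b => le_trans (gsetMorP f a b) (gsetMorP g _ _)).

Lemma gset_comp1 X Y (f : gsetMor X Y) : gset_comp f (gset_id X) = f.
Proof. exact: gsetMor_eq. Qed.

Lemma gset_1comp X Y (f : gsetMor X Y) : gset_comp (gset_id Y) f = f.
Proof. exact: gsetMor_eq. Qed.

Lemma gset_compA W X Y Z (h : gsetMor Y Z) (g : gsetMor X Y) (f : gsetMor W X) :
  gset_comp h (gset_comp g f) = gset_comp (gset_comp h g) f.
Proof. exact: gsetMor_eq. Qed.

Definition betaG : category :=
  @Category gset gsetMor gset_id gset_comp gset_comp1 gset_1comp gset_compA.

Definition betaG_forget : functor betaG Ens :=
  @Functor betaG Ens gset_sort (fun X Y f => gsetMor_fun f)
    (fun _ => erefl) (fun _ _ _ _ _ => erefl).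

Section GProd.
Variables X Y : gset.

Definition gprod_act (p q : X * Y) : G := act p.1 q.1 `&` act p.2 q.2.

Lemma gprod_lbij : lbijection gprod_act.
Proof.
have bot2 (x y z w : G) : x `&` z = \bot -> (x `&` y) `&` (z `&` w) = \bot.
  by move=> xz; rewrite meetACA xz meet0x.
have bot2' (x y z w : G) : y `&` w = \bot -> (x `&` y) `&` (z `&` w) = \bot.
  by move=> xz; rewrite meetACA xz meetx0.
have neq (b1 b2 : X * Y) : b1 <> b2 -> b1.1 <> b2.1 \/ b1.2 <> b2.2.
  move=> b12; apply: contrapT => /not_orP[/contrapT h1 /contrapT h2].
  by apply: b12; rewrite (surjective_pairing b1) h1 h2 -surjective_pairing.
split.
- move=> [a a']; apply/le_anti; rewrite lex1/= -(meetxx \top).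
  rewrite -{1}(lbij_ed (act_lbij X) a) -(lbij_ed (act_lbij Y) a') ssup_meet.
  apply: ssup_le => _ [_ [x _ <-] <-]; rewrite meet_ssup.
  by apply: ssup_le => _ [_ [y _ <-] <-]; apply: ssup_ub; exists (x, y).
- move=> x b1 b2 /neq[] h; rewrite /gprod_act.
    by apply: bot2; exact: (lbij_uv (act_lbij X)).
  by apply: bot2'; exact: (lbij_uv (act_lbij Y)).
- move=> [a a']; apply/le_anti; rewrite lex1/= -(meetxx \top).
  rewrite -{1}(lbij_su (act_lbij X) a) -(lbij_su (act_lbij Y) a') ssup_meet.
  apply: ssup_le => _ [_ [x _ <-] <-]; rewrite meet_ssup.
  by apply: ssup_le => _ [_ [y _ <-] <-]; apply: ssup_ub; exists (x, y).
- move=> x b1 b2 /neq[] h; rewrite /gprod_act.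
    by apply: bot2; exact: (lbij_in (act_lbij X)).
  by apply: bot2'; exact: (lbij_in (act_lbij Y)).
Qed.

Lemma gprod_comul p q :
  comul G (gprod_act p q) = ssup (range (fun r => gprod_act p r ⊗ gprod_act r q)).
Proof.
rewrite /gprod_act localeMor_meet !act_comul ssup_meet.
apply: ssup_eq => [_ [_ [x _ <-] <-]|U h].
  rewrite meet_ssup; apply: ssup_le => _ [_ [y _ <-] <-].
  by rewrite pure_meet; apply: ssup_ub; exists (x, y).
apply: ssup_le => _ [[x y] _ <-] /=; rewrite -pure_meet.
apply: le_trans (h _ (imageP _ _)); last by exists x.
by apply: leI2 => //; apply: ssup_ub; exists y.
Qed.

Lemma gprod_counit p q : counit G (gprod_act p q) = `[< p = q >].
Proof.
rewrite localeMor_meet !act_counit; case: p q => [x y] [x' y'] /=.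
apply/idP/idP => [/andP[/asboolP-> /asboolP->]|/asboolP[-> ->]]; first exact/asboolP.
by apply/andP; split; exact/asboolP.
Qed.

Lemma gprod_antipode p q : antipode G (gprod_act p q) = gprod_act q p.
Proof. by rewrite localeMor_meet !act_antipode. Qed.

Definition gprod : gset := GSet gprod_lbij gprod_comul gprod_counit gprod_antipode.

Definition gprod_fst : gsetMor gprod X := @GSetMor gprod X fst (fun p q => leIl _ _).
Definition gprod_snd : gsetMor gprod Y := @GSetMor gprod Y snd (fun p q => leIr _ _).

Definition gprod_pair Z (f : gsetMor Z X) (g : gsetMor Z Y) : gsetMor Z gprod.
Proof.
by exists (fun z => (f z, g z)) => a b; rewrite lexI /= !gsetMorP.
Defined.

Lemma gprod_is_product : @is_product betaG X Y gprod gprod_fst gprod_snd.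
Proof.
move=> Z f g; exists (gprod_pair f g); split; first by split; exact: gsetMor_eq.
move=> h [<- <-]; apply: gsetMor_eq => z /=.
by case: (h z).
Qed.

End GProd.

Lemma linear_bot {d1 d2} {L : localeType d1} {M : localeType d2}
  (f : linear L M) : f \bot = \bot.
Proof. by rewrite -{1}ssup0 linearP image_set0 ssup0. Qed.

Lemma act_sym_bot (X : gset) (a b : X) : act a b = \bot -> act b a = \bot.
Proof. by move=> ab; rewrite -act_antipode ab linear_bot. Qed.

Section GSub.
Variables (X : gset) (P : set X).
Hypothesis PP : forall a b, P a -> ~ P b -> act a b = \bot.

Definition gsub_act (a b : {x | P x}) : G := act (sval a) (sval b).

Lemma sval_inj (a b : {x | P x}) : sval a = sval b -> a = b.
Proof.
case: a b => [a Pa] [b Pb] /= ab; subst b.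
by congr exist; exact: Prop_irrelevance.
Qed.

Lemma gsub_lbij : lbijection gsub_act.
Proof.
split.
- move=> [a Pa]; rewrite /gsub_act -[RHS](lbij_ed (act_lbij X) a).
  apply: ssup_eq => [_ [[b Pb] _ <-]|y h]; first by apply: ssup_ub; exists b.
  apply: ssup_le => _ [b _ <-]; have [Pb|nPb] := pselect (P b).
    by apply: h; exists (exist _ b Pb).
  by rewrite PP// le0x.
- by move=> x b1 b2 b12; apply: (lbij_uv (act_lbij X)) => /sval_inj.
- move=> [a Pa]; rewrite /gsub_act -[RHS](lbij_su (act_lbij X) a).
  apply: ssup_eq => [_ [[b Pb] _ <-]|y h]; first by apply: ssup_ub; exists b.
  apply: ssup_le => _ [b _ <-]; have [Pb|nPb] := pselect (P b).
    by apply: h; exists (exist _ b Pb).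
  by rewrite act_sym_bot ?le0x//; exact: PP.
- by move=> x b1 b2 b12; apply: (lbij_in (act_lbij X)) => /sval_inj.
Qed.

Lemma gsub_comul p q :
  comul G (gsub_act p q) = ssup (range (fun r => gsub_act p r ⊗ gsub_act r q)).
Proof.
rewrite act_comul; apply/esym/ssup_eq => [_ [[b Pb] _ <-]|y h].
  by apply: ssup_ub; exists b.
apply: ssup_le => _ [b _ <-]; have [Pb|nPb] := pselect (P b).
  by apply: h; exists (exist _ b Pb).
by rewrite PP//; [apply/pure_leP/tensor_bot; left|exact: svalP].
Qed.

Lemma gsub_counit p q : counit G (gsub_act p q) = `[< p = q >].
Proof.
rewrite act_counit; apply/idP/idP => /asboolP h; apply/asboolP; first exact: sval_inj.
by rewrite h.
Qed.

Lemma gsub_antipode p q : antipode G (gsub_act p q) = gsub_act q p.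
Proof. exact: act_antipode. Qed.

Definition gsub : gset := GSet gsub_lbij gsub_comul gsub_counit gsub_antipode.

Definition gsub_incl : gsetMor gsub X :=
  @GSetMor gsub X sval (fun a b => lexx _).

End GSub.

Lemma gsetMor_act (X Y : gset) (f : gsetMor X Y) a c :
  act (f a) c = ssup [set act a b | b in [set b | f b = c]].
Proof.
apply/esym/ssup_eq => [_ [b <- <-]|y h]; first exact: gsetMorP.
rewrite -[leLHS]meetx1 -(lbij_ed (act_lbij X) a) meet_ssup.
apply: ssup_le => _ [_ [b _ <-] <-]; have [fbc|fbc] := pselect (f b = c).
  by apply: le_trans (h _ (imageP _ fbc)); exact: leIr.
apply: le_trans (leI2 (lexx _) (gsetMorP f _ _)) _.
by rewrite (lbij_uv (act_lbij Y)) ?le0x// => cfb; apply: fbc.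
Qed.

Lemma range_stable (X Y : gset) (f : gsetMor X Y) a b :
  range f a -> ~ range f b -> act a b = \bot.
Proof.
move=> [x _ <-] fb; rewrite gsetMor_act; apply: ssup_bot => _ [y fyb <-].
by case: fb; exists y.
Qed.

Section GPullback.
Variables (X Y Z : gset) (f : gsetMor X Z) (g : gsetMor Y Z).

Lemma gpullback_stable (p q : gprod X Y) :
  f p.1 = g p.2 -> ~ (f q.1 = g q.2) -> act p q = \bot.
Proof.
move=> fgp fgq; apply/le_anti; rewrite le0x andbT.
apply: le_trans (leI2 (gsetMorP f _ _) (gsetMorP g _ _)) _.
by rewrite fgp (lbij_uv (act_lbij Z)).
Qed.

Definition gpullback : gset :=
  @gsub (gprod X Y) [set p | f p.1 = g p.2] gpullback_stable.

Definition gpullback_fst : gsetMor gpullback X :=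
  gset_comp (gprod_fst X Y) (gsub_incl _).
Definition gpullback_snd : gsetMor gpullback Y :=
  gset_comp (gprod_snd X Y) (gsub_incl _).

Lemma gpullback_is_pullback :
  @is_pullback betaG X Y Z gpullback f g gpullback_fst gpullback_snd.
Proof.
split; first by apply: gsetMor_eq => -[p pP].
move=> W u v fugv.
have fg w : f (u w) = g (v w) by have /(congr1 (fun h => gsetMor_fun h w)) := fugv.
have hP a b : act a b <= act (gprod_pair u v a) (gprod_pair u v b).
  exact: gsetMorP.
exists (@GSetMor W gpullback (fun w => exist _ (u w, v w) (fg w)) hP).
split; first by split; exact: gsetMor_eq.
move=> h [hu hv]; apply: gsetMor_eq => w; apply: sval_inj => /=.
have /(congr1 (fun k => gsetMor_fun k w)) /= <- := hu.
have /(congr1 (fun k => gsetMor_fun k w)) /= <- := hv.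
by rewrite -surjective_pairing.
Qed.

End GPullback.

Lemma gmono_inj (X : gset) (m : monoInto (X : betaG)) :
  injective (mono_arr m : gsetMor _ _).
Proof.
move=> x y mxy; set M : gset := mono_dom m in x y mxy *.
have := @mono_arrP _ _ m (gpullback (mono_arr m) (mono_arr m))
  (gpullback_fst _ _) (gpullback_snd _ _) (gpullback_is_pullback _ _).1.
move/(congr1 (fun h : gsetMor (gpullback _ _) M => h (exist _ (x, y) mxy))).
exact.
Qed.

Lemma inj_mono (X Y : gset) (f : gsetMor X Y) : injective f -> @mono betaG X Y f.
Proof.
move=> fi Z g h fgh; apply: gsetMor_eq => z; apply: fi.
by have /(congr1 (fun h => gsetMor_fun h z)) := fgh.
Qed.

Definition mono_range (X : betaG) (m : monoInto X) : set X :=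
  range (fhom betaG_forget m).

Lemma factors_range (X Y : gset) (h : gsetMor Y X) (n : monoInto (X : betaG)) :
  @factors betaG _ _ _ h n <-> range h `<=` mono_range n.
Proof.
split=> [[e <-] _ [y _ <-]|hn]; first by exists ((e : gsetMor _ _) y).
pose N : gset := mono_dom n; pose n' : gsetMor N X := mono_arr n.
have /choice[e eP] y : exists z : N, n' z = h y.
  by have [z _ <-] := hn (h y) (imageP _ I); exists z.
have eM a b : act a b <= act (e a) (e b).
  apply: le_trans (gsetMorP h a b) _; rewrite -!eP gsetMor_act.
  by apply: ssup_le => _ [z /gmono_inj -> <-].
by exists (GSetMor eM); apply: gsetMor_eq => y /=; exact: eP.
Qed.

Lemma mono_equiv_range (X : betaG) (m n : monoInto X) :
  mono_equiv m n <-> mono_range m = mono_range n.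
Proof.
split=> [[/factors_range mn /factors_range nm]|mn]; first exact/seteqP.
by split; apply/factors_range; rewrite -/(mono_range _) mn.
Qed.

Lemma gsub_incl_mono (X : gset) (P : set X)
    (PP : forall a b, P a -> ~ P b -> act a b = \bot) :
  @mono betaG _ _ (gsub_incl PP).
Proof. by apply: inj_mono => a b; exact: sval_inj. Qed.

Definition range_mono (X Y : gset) (h : gsetMor Y X) : monoInto (X : betaG) :=
  MonoInto (@gsub_incl_mono _ _ (@range_stable _ _ h)).

Lemma range_monoE (X Y : gset) (h : gsetMor Y X) :
  mono_range (range_mono h) = range h.
Proof.
apply/seteqP; split=> x; first by move=> [[z hz] _ <-].
by move=> hx; exists (exist _ x hx).
Qed.

Lemma is_image_range (X Y : gset) (h : gsetMor Y X) (m : monoInto (X : betaG)) :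
  @is_image betaG _ _ h m <-> mono_range m = range h.
Proof.
split=> [[/factors_range hm mmin]|mh].
  apply/seteqP; split=> //; rewrite -(range_monoE h); apply/factors_range/mmin.
  by apply/factors_range; rewrite range_monoE.
split=> [|n /factors_range hn]; first by apply/factors_range; rewrite mh.
by apply/factors_range; rewrite -/(mono_range m) mh.
Qed.

(* The forgetful functor preserves monomorphisms and sends [gprod X Y] to the
   cartesian product; a subobject of a set is identified with its image. *)
Definition underlying (X : betaG) (R : subobject X) : set X :=
  [set x | exists2 m, R m & range (fhom betaG_forget m) x].

Lemma underlyingE (X : betaG) (R : subobject X) (m : monoInto X) :
  R m <-> mono_range m = underlying R.
Proof.
have [n Rn] := mono_classP R.
have RE k : R k <-> mono_range n = mono_range k by rewrite Rn; exact: mono_equiv_range.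
have uR : underlying R = mono_range n.
  apply/seteqP; split=> x; first by move=> [k /RE -> kx].
  by move=> nx; exists n => //; exact/RE.
by rewrite uR RE; split=> ->.
Qed.

Lemma underlying_inj (X : betaG) (R S : subobject X) :
  underlying R = underlying S -> R = S.
Proof.
move=> RS; have : mono_class R = mono_class S.
  by apply/funext => m; apply/propext; rewrite !underlyingE RS.
case: R S {RS} => [R RP] [S SP] /= RS; subst S.
by congr Subobject; exact: Prop_irrelevance.
Qed.

Lemma mono_equiv_classP (X : betaG) (m : monoInto X) :
  exists n, mono_equiv m = mono_equiv n.
Proof. by exists m. Qed.

Definition gdiag (X : gset) : gsetMor X (gprod X X) :=
  gprod_pair (gset_id X) (gset_id X).

Lemma gdiag_mono (X : gset) : @mono betaG _ _ (gdiag X).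
Proof. by apply: inj_mono => x y []. Qed.

Definition grel (X Y : gset) := @subobject betaG (gprod X Y).

Definition grel_id (X : gset) : grel X X :=
  Subobject (mono_equiv_classP (MonoInto (@gdiag_mono X))).

Definition grel_comp_class (X Y Z : gset) (S : grel Y Z) (R : grel X Y)
    (t : monoInto (gprod X Z : betaG)) : Prop :=
  exists2 r, mono_class R r & exists2 s, mono_class S s &
    @is_composite betaG X Y Z (gprod X Y) (gprod Y Z) (gprod X Z)
      (gprod_fst X Y) (gprod_snd X Y) (gprod_fst Y Z) (gprod_snd Y Z)
      (gprod_fst X Z) (gprod_snd X Z) r s t.

Lemma is_composite_range (X Y Z : gset) r s t :
  @is_composite betaG X Y Z (gprod X Y) (gprod Y Z) (gprod X Z)
      (gprod_fst X Y) (gprod_snd X Y) (gprod_fst Y Z) (gprod_snd Y Z)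
      (gprod_fst X Z) (gprod_snd X Z) r s t <->
  mono_range t = rel_comp (mono_range s) (mono_range r).
Proof.
pose f : gsetMor _ _ := gset_comp (gprod_snd X Y) (mono_arr r).
pose g : gsetMor _ _ := gset_comp (gprod_fst Y Z) (mono_arr s).
split.
  move=> [w [p [q [h [[pq pull] h1 h2 /is_image_range ->]]]]].
  have h1w x : ((h : gsetMor _ _) x).1 = ((mono_arr r : gsetMor _ _) ((p : gsetMor _ _) x)).1.
    by have /(congr1 (fun k => gsetMor_fun k x)) := h1.
  have h2w x : ((h : gsetMor _ _) x).2 = ((mono_arr s : gsetMor _ _) ((q : gsetMor _ _) x)).2.
    by have /(congr1 (fun k => gsetMor_fun k x)) := h2.
  apply/seteqP; split=> -[x z].
    move=> [v _ hv]; have := h1w v; have := h2w v; rewrite hv /= => zE xE.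
    exists ((mono_arr r : gsetMor _ _) ((p : gsetMor _ _) v)).2.
      by exists ((p : gsetMor _ _) v) => //=; rewrite xE -surjective_pairing.
    exists ((q : gsetMor _ _) v) => //=; rewrite zE.
    have /(congr1 (fun k => gsetMor_fun k v)) /= -> := pq.
    by rewrite -surjective_pairing.
  move=> /= [y [a _ ra] [b _ sb]].
  have fg : f a = g b by move: ra sb => /= ra sb; rewrite /= ra sb.
  have [e [[ep eq] _]] := pull _ _ _ (gpullback_is_pullback f g).1.
  pose v := (e : gsetMor _ _) (exist _ (a, b) fg).
  have /(congr1 (fun k : gsetMor (gpullback f g) _ => k (exist _ (a, b) fg))) /= pv := ep.
  have /(congr1 (fun k : gsetMor (gpullback f g) _ => k (exist _ (a, b) fg))) /= qv := eq.
  exists v => //=; rewrite [LHS]surjective_pairing h1w h2w /v pv qv.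
  by move: ra sb => /= -> ->.
move=> tE; exists (gpullback f g), (gpullback_fst f g), (gpullback_snd f g).
exists (gprod_pair
  (gset_comp (gset_comp (gprod_fst X Y) (mono_arr r)) (gpullback_fst f g))
  (gset_comp (gset_comp (gprod_snd Y Z) (mono_arr s)) (gpullback_snd f g))).
split; [exact: gpullback_is_pullback|exact: gsetMor_eq|exact: gsetMor_eq|].
apply/is_image_range; rewrite tE; apply/seteqP; split=> -[x z].
  move=> /= [y [a _ ra] [b _ sb]].
  have fg : f a = g b by move: ra sb => /= ra sb; rewrite /= ra sb.
  by exists (exist _ (a, b) fg) => //=; move: ra sb => /= -> ->.
move=> [[[a b] /= fg] _ [<- <-]]; exists (f a).
  by exists a => //=; rewrite -surjective_pairing.
by exists b => //=; rewrite fg /= -surjective_pairing.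
Qed.

Lemma grel_comp_classE (X Y Z : gset) (S : grel Y Z) (R : grel X Y) t :
  grel_comp_class S R t <->
  mono_range t = rel_comp (underlying S) (underlying R).
Proof.
split.
  by move=> [r /underlyingE <- [s /underlyingE <-]] /is_composite_range.
have [r Rr] : exists r, R r by have [r ->] := mono_classP R; exists r; exact/mono_equiv_range.
have [s Ss] : exists s, S s by have [s ->] := mono_classP S; exists s; exact/mono_equiv_range.
move=> tE; exists r => //; exists s => //; apply/is_composite_range; rewrite tE.
by move/underlyingE: Rr => ->; move/underlyingE: Ss => ->.
Qed.

Lemma grel_comp_classP (X Y Z : gset) (S : grel Y Z) (R : grel X Y) :
  exists t, grel_comp_class S R = mono_equiv t.
Proof.
have [r Rr] : exists r, R r by have [r ->] := mono_classP R; exists r; exact/mono_equiv_range.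
have [s Ss] : exists s, S s by have [s ->] := mono_classP S; exists s; exact/mono_equiv_range.
pose f : gsetMor _ _ := gset_comp (gprod_snd X Y) (mono_arr r).
pose g : gsetMor _ _ := gset_comp (gprod_fst Y Z) (mono_arr s).
pose h : gsetMor _ _ := gprod_pair
  (gset_comp (gset_comp (gprod_fst X Y) (mono_arr r)) (gpullback_fst f g))
  (gset_comp (gset_comp (gprod_snd Y Z) (mono_arr s)) (gpullback_snd f g)).
have ht : grel_comp_class S R (range_mono h).
  exists r => //; exists s => //.
  exists (gpullback f g), (gpullback_fst f g), (gpullback_snd f g), h.
  split; [exact: gpullback_is_pullback|exact: gsetMor_eq|exact: gsetMor_eq|].
  by apply/is_image_range; rewrite range_monoE.
exists (range_mono h); apply/funext => t; apply/propext.
rewrite mono_equiv_range grel_comp_classE.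
by move/grel_comp_classE: ht => ->; split=> ->.
Qed.

Definition grel_comp (X Y Z : gset) (S : grel Y Z) (R : grel X Y) : grel X Z :=
  Subobject (grel_comp_classP S R).

Lemma underlying_id (X : gset) : underlying (grel_id X) = @rel_id X.
Proof.
have /underlyingE <- : grel_id X (MonoInto (@gdiag_mono X)) by exact/mono_equiv_range.
apply/seteqP; split=> -[x y]; first by move=> [z _ [<- <-]].
by rewrite /rel_id/= => ->; exists y.
Qed.

Lemma underlying_comp (X Y Z : gset) (S : grel Y Z) (R : grel X Y) :
  underlying (grel_comp S R) = rel_comp (underlying S) (underlying R).
Proof.
have [t tE] := grel_comp_classP S R.
have ht : grel_comp_class S R t by rewrite tE; exact/mono_equiv_range.
rewrite -(grel_comp_classE S R t).1//; apply/esym/underlyingE; exact: ht.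
Qed.

Lemma grel_comp1 X Y (R : grel X Y) : grel_comp R (grel_id X) = R.
Proof. by apply: underlying_inj; rewrite underlying_comp underlying_id rel_comp1. Qed.

Lemma grel_1comp X Y (R : grel X Y) : grel_comp (grel_id Y) R = R.
Proof. by apply: underlying_inj; rewrite underlying_comp underlying_id rel_1comp. Qed.

Lemma grel_compA W X Y Z (T : grel Y Z) (S : grel X Y) (R : grel W X) :
  grel_comp T (grel_comp S R) = grel_comp (grel_comp T S) R.
Proof. by apply: underlying_inj; rewrite !underlying_comp rel_compA. Qed.

Definition RelBetaG : category :=
  @Category gset grel grel_id grel_comp grel_comp1 grel_1comp grel_compA.

Definition RelBetaG_forget : functor RelBetaG Rel :=
  @Functor RelBetaG Rel gset_sort (fun X Y R => underlying R)
    underlying_id underlying_comp.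

End GSets.

(* Main.v *)
(* A coaction on the free sup-lattice of X is a matrix mu : X * X -> G, whose
   entries are the coefficients of the coaction on singletons, and the comodule
   axioms are the conditions of a G-set on w and e. The antipode turns the matrix
   [iota mu] into a two-sided inverse of [mu] for the product (ssup, meet), and
   over a locale the inverse of a matrix is its transpose: this gives the remaining
   axioms, i.e. that mu is an l-bijection and that iota mu(a, b) = mu(b, a).

   On arrows, both the comodule morphism equation for a relation R and the
   invariance of R as a subset of the product G-set amount to
   ssup_(b | R a b) mu'(b, y) = ssup_(x | R x y) mu(a, x).

   The two functors are mutually inverse on objects and commute with faithful
   forgetful functors to [Sup0], so their composites are identities. *)

Require Import Defs.
From mathcomp Require Import all_boot all_order.
From mathcomp Require Import boolp classical_sets.

Set Implicit Arguments.
Unset Strict Implicit.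
Unset Printing Implicit Defensive.

Import Order.TTheory.
Local Open Scope classical_set_scope.
Local Open Scope order_scope.

Local Notation isup F := (ssup (range F)).

(** * Suprema of indexed families *)

Section IndexedSup.
Context {d d' : Order.disp_t} {S : supLatticeType d} {T : supLatticeType d'}.

Lemma isup_ub X (F : X -> S) x : F x <= isup F.
Proof. by apply: ssup_ub; exists x. Qed.

Lemma isup_le X (F : X -> S) s : (forall x, F x <= s) -> isup F <= s.
Proof. by move=> h; apply: ssup_le => _ [x _ <-]. Qed.

Lemma eq_isup X (F F' : X -> S) : F =1 F' -> isup F = isup F'.
Proof. by move=> /funext ->. Qed.

Lemma isup_exchange X Y (F : X -> Y -> S) :
  isup (fun x => isup (F x)) = isup (fun y => isup (F^~ y)).
Proof.
apply/le_anti/andP; split; apply: isup_le => ?; apply: isup_le => ?.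
  by apply: le_trans (isup_ub _ _); exact: isup_ub (F^~ _) _.
by apply: le_trans (isup_ub _ _); exact: isup_ub.
Qed.

Lemma linear_isup X (f : S -> T) (F : X -> S) : is_linear f ->
  f (isup F) = isup (fun x => f (F x)).
Proof. by move=> ->; rewrite image_comp. Qed.

End IndexedSup.

(** * Power sets as free sup-lattices *)

Section FreeSupLattice.
Context {d : Order.disp_t} {S : supLatticeType d}.

Lemma set_ssup X (A : set X) : A = ssup [set [set x] | x in A].
Proof.
apply/seteqP; split=> x; first by move=> Ax; exists [set x] => //; exists x.
by move=> [_ [z Az <-] ->].
Qed.

Lemma free_ext X (f g : set X -> S) : is_linear f -> is_linear g ->
  (forall x, f [set x] = g [set x]) -> f =1 g.
Proof.
move=> fl gl fg A; rewrite (set_ssup A) fl gl !image_comp; congr ssup.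
by apply: eq_imagel => x _ /=.
Qed.

Definition free_ext_fun X (f : X -> S) (A : set X) : S := ssup (f @` A).

Lemma free_ext_linear X (f : X -> S) : is_linear (free_ext_fun f).
Proof.
move=> A; rewrite /free_ext_fun -ssup_bigcup; congr ssup.
apply/seteqP; split=> s; first by move=> [x [B AB Bx] <-]; exists B => //; exists x.
by move=> [B AB [x Bx <-]]; exists x => //; exists B.
Qed.

Definition free_lift X (f : X -> S) := Linear (free_ext_linear f).

Lemma free_lift1 X (f : X -> S) x : free_lift f [set x] = f x.
Proof. by rewrite /= /free_ext_fun image_set1 ssup1. Qed.

End FreeSupLattice.

(** * Coefficients of tensors over a free sup-lattice *)

Section Coefficients.
Context {d : Order.disp_t} {L : localeType d}.

Lemma coef_bilinear X (y : X) :
  bilinear (fun (g : L) (A : set X) => if `[< A y >] then g else \bot).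
Proof.
split=> [A B|g C] /=.
  case: asboolP => _; first by rewrite image_id.
  by apply/esym/ssup_bot => _ [g _ <-].
apply/esym/ssup_eq => [_ [A CA <-]|z h].
  case: asboolP => Ay; last exact: le0x.
  by case: asboolP => // -[]; exists A.
case: asboolP => [[A CA Ay]|_]; last exact: le0x.
by have := h _ (imageP _ CA); case: asboolP.
Qed.

(** The projection of index [y] under the isomorphism of [tensor L (set X)] with the power of [L]
    indexed by [X]; [coef_isup] and [tensor_coef] are its two inverse laws. *)
Definition coef X (y : X) : linear (tensor L (set X)) L :=
  Linear (tlift_is_linear (coef_bilinear y)).

Lemma coef_pure X (y : X) g A : coef y (g ⊗ A) = if `[< A y >] then g else \bot.
Proof. by rewrite /= tlift_pure//; exact: coef_bilinear. Qed.

Lemma coef_isup X (g : X -> L) (y : X) :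
  coef y (isup (fun x => g x ⊗ [set x])) = g y.
Proof.
rewrite linear_isup; last exact: linearP.
apply/le_anti/andP; split.
  apply: isup_le => x; rewrite [X in X <= _]coef_pure.
  by case: asboolP => [->|_] //; exact: le0x.
apply: le_trans (isup_ub _ y); rewrite [X in _ <= X]coef_pure.
by rewrite asboolT.
Qed.

(** As an equality of linear functions this reduces to pure tensors, where [g ⊗ A] is the supremum
    of the [g ⊗ [set x]] for [x] in [A]. *)
Lemma tensor_coef X : @id (tensor L (set X)) =1
  (fun U => isup (fun x => coef x U ⊗ [set x])).
Proof.
apply: tensor_ext; [exact: is_linear_id|move=> A|move=> g A].
- under eq_isup do rewrite linearP pure_bilinear.1 image_comp.
  apply/le_anti/andP; split.
    apply: isup_le => x; apply: ssup_le => _ [U AU <-] /=.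
    apply: (@le_trans _ _ (isup (fun x => coef x U ⊗ [set x]))).
      exact: (isup_ub (fun x => coef x U ⊗ [set x])).
    by apply: ssup_ub; exists U.
  apply: ssup_le => _ [U AU <-]; apply: isup_le => x.
  apply: le_trans (isup_ub _ x).
  by apply: ssup_ub; exists U.
- rewrite {1}(set_ssup A) pure_bilinear.2 image_comp.
  apply/le_anti/andP; split.
    apply: ssup_le => _ [x Ax <-]; apply: le_trans (isup_ub _ x).
    by rewrite coef_pure asboolT.
  apply: isup_le => x; rewrite coef_pure; case: asboolP => Ax.
    by apply: ssup_ub; exists x.
  by apply/pure_leP/tensor_bot; left.
Qed.

Lemma coef_inj X (U V : tensor L (set X)) :
  (forall x, coef x U = coef x V) -> U = V.
Proof.
move=> UV; rewrite [LHS](tensor_coef U) [RHS](tensor_coef V).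
by apply: eq_isup => x; rewrite UV.
Qed.

Lemma tmap_coef {d'} {S : supLatticeType d'} X (g : linear (set X) S)
    (U : tensor L (set X)) :
  tmap (linear_id L) g U = isup (fun x => coef x U ⊗ g [set x]).
Proof.
rewrite {1}[U]tensor_coef linear_isup; last exact: linearP.
by apply: eq_isup => x; rewrite [LHS]tmap_pure.
Qed.

End Coefficients.

Lemma coef_tmap {d d'} {L : localeType d} {M : localeType d'} X (y : X)
    (f : linear L M) (U : tensor L (set X)) :
  coef y (tmap f (linear_id (set X)) U) = f (coef y U).
Proof.
suff h : coef y \o tmap f (linear_id (set X)) =1 f \o coef y by exact: h.
apply: tensor_ext; [|apply: is_linear_comp; exact: linearP|].
  by apply: is_linear_comp; exact: linearP.
move=> g A; rewrite [LHS]/comp tmap_pure [RHS]/comp !coef_pure.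
by case: asboolP => // _; rewrite linear_bot.
Qed.

(** Lets coassociativity be read one coefficient at a time. *)
Lemma coef_tassoc {d d'} {L : localeType d} {M : localeType d'} X (y : X)
    (U : tensor (tensor L M) (set X)) :
  tmap (linear_id L) (coef y) (tassoc (set X) U) = coef y U.
Proof.
suff h : tmap (linear_id L) (coef y) \o tassoc (set X) =1
  (coef y : linear (tensor (tensor L M) (set X)) _) by exact: h.
apply: tensor_ext; [|exact: linearP|].
  by apply: is_linear_comp; exact: linearP.
(* The left factor is itself a tensor, so extensionality is applied a second time, with [A]
   fixed. *)
move=> {}U A; move: U; apply: tensor_ext.
- apply: (@is_linear_comp _ _ _ _ _ _ _ (fun U => U ⊗ A)).
    by apply: is_linear_comp; exact: linearP.
  exact: pure_bilinear.1.
- apply: (@is_linear_comp _ _ _ _ _ _ (coef y) (fun U => U ⊗ A)).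
    exact: linearP.
  exact: pure_bilinear.1.
move=> g h; rewrite [LHS]/comp tassoc_pure tmap_pure !coef_pure.
by case: asboolP => // _; apply/le_anti; rewrite le0x andbT;
   apply/pure_leP/tensor_bot; right.
Qed.

(** * Invertible matrices over a locale *)

(* In [M x a = M x a `&` ssup_y (M x y `&` N y x)] only the term [y = a] survives,
   because [N y x `&` M x a] vanishes for [y <> a]. *)
Lemma le_inverse_matrix {d} {L : localeType d} X (M N : X -> X -> L) :
  (forall a b, isup (fun x => M a x `&` N x b) = initial_mor L `[< a = b >]) ->
  (forall a b, isup (fun x => N a x `&` M x b) = initial_mor L `[< a = b >]) ->
  forall x a, M x a <= N a x.
Proof.
move=> MN NM x a; rewrite -[leLHS]meetx1.
have := MN x x; rewrite asboolT//= => <-.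
rewrite meet_ssup image_comp; apply: isup_le => y /=.
have [->|ya] := pselect (y = a).
  exact: le_trans (leIr _ _) (leIr _ _).
have NM0 : N y x `&` M x a = \bot.
  apply/le_anti; rewrite le0x andbT.
  apply: le_trans (isup_ub (fun x => N y x `&` M x a) x) _.
  by rewrite NM asboolF.
by rewrite meetCA [M x a `&` _]meetC NM0 meetx0 le0x.
Qed.

Section InverseMatrix.
Context {d : Order.disp_t} {L : localeType d} {X : Type} (M N : X -> X -> L).
Hypothesis MN :
  forall a b, isup (fun x => M a x `&` N x b) = initial_mor L `[< a = b >].
Hypothesis NM :
  forall a b, isup (fun x => N a x `&` M x b) = initial_mor L `[< a = b >].

(** The hypotheses are symmetric in [M] and [N], so [le_inverse_matrix] applies in both
    directions. *)
Lemma inverse_matrixE a b : N a b = M b a.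
Proof. by apply/le_anti; rewrite !le_inverse_matrix. Qed.

(** Diagonal entries of the two products give (ed) and (su); off-diagonal entries, with [N] read as
    the transpose of [M], give (uv) and (in). *)
Lemma inverse_matrix_lbijection : lbijection M.
Proof.
split=> [a|x b1 b2 b12|b|y a1 a2 a12].
- apply/le_anti; rewrite lex1 /=; have := MN a a; rewrite asboolT//= => <-.
  by apply: isup_le => x; apply: le_trans (leIl _ _) (isup_ub _ _).
- apply/le_anti; rewrite le0x andbT -inverse_matrixE.
  apply: le_trans (isup_ub (fun x => N b1 x `&` M x b2) x) _.
  by rewrite NM asboolF.
- apply/le_anti; rewrite lex1 /=; have := NM b b; rewrite asboolT//= => <-.
  by apply: isup_le => x; apply: le_trans (leIr _ _) (isup_ub (M^~ b) _).
- apply/le_anti; rewrite le0x andbT -(inverse_matrixE y a2).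
  apply: le_trans (isup_ub (fun y => M a1 y `&` N y a2) y) _.
  by rewrite MN asboolF.
Qed.

End InverseMatrix.

Section ComodulesAndActions.
Context {d : Order.disp_t} (G : localicGroup d).

(** * From comodules to G-sets *)

Section Matrix.
Variable M : comodule G.
Let X := comodule_set M.

Definition coact_matrix (a b : X) : G := coef b (coact M [set a]).

(** This is the coefficient at [b] of coassociativity on [[set a]]. *)
Lemma coact_matrix_comul a b : comul G (coact_matrix a b) =
  isup (fun x => coact_matrix a x ⊗ coact_matrix x b).
Proof.
rewrite /coact_matrix -(coef_tmap b (comul G)) -coef_tassoc.
rewrite coact_comul tmap_coef.
rewrite linear_isup; last exact: linearP.
by apply: eq_isup => x; rewrite [LHS]tmap_pure.
Qed.

Lemma coact_matrix_counit a b : counit G (coact_matrix a b) = `[< a = b >].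
Proof.
rewrite -(coef_tmap b (counit G)) coact_counit coef_pure.
by have [->|ab] := pselect (a = b); [rewrite !asboolT|rewrite !asboolF//; exact/nesym].
Qed.

(** The antipode axiom at the entry of index [a], [b], with [comul] expanded as a matrix product;
    the right-hand side is the identity matrix. *)
Lemma coact_matrix_antipodel a b :
  isup (fun x => antipode G (coact_matrix a x) `&` coact_matrix x b) =
  initial_mor G `[< a = b >].
Proof.
rewrite -coact_matrix_counit -antipodel coact_matrix_comul.
rewrite linear_isup; last exact: linearP.
rewrite linear_isup; last by apply: tlift_is_linear;
  split=> [z|z] A; [exact: ssup_meet|exact: meet_ssup].
by apply: eq_isup => x; rewrite tmap_pure codiagonal_pure.
Qed.

Lemma coact_matrix_antipoder a b :
  isup (fun x => coact_matrix a x `&` antipode G (coact_matrix x b)) =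
  initial_mor G `[< a = b >].
Proof.
rewrite -coact_matrix_counit -antipoder coact_matrix_comul.
rewrite linear_isup; last exact: linearP.
rewrite linear_isup; last by apply: tlift_is_linear;
  split=> [z|z] A; [exact: ssup_meet|exact: meet_ssup].
by apply: eq_isup => x; rewrite tmap_pure codiagonal_pure.
Qed.

Definition gset_of_comodule : gset G :=
  GSet (inverse_matrix_lbijection (N := fun a b => antipode G (coact_matrix a b))
          coact_matrix_antipoder coact_matrix_antipodel)
    coact_matrix_comul coact_matrix_counit
    (inverse_matrixE (N := fun a b => antipode G (coact_matrix a b))
       coact_matrix_antipoder coact_matrix_antipodel).

End Matrix.

(** * From G-sets to comodules *)

Section Coaction.
Variable X : gset G.

Definition act_coact : linear (set X) (tensor G (set X)) :=
  free_lift (fun a => isup (fun x => act a x ⊗ [set x])).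

Lemma coef_act_coact a b : coef b (act_coact [set a]) = act a b.
Proof. by rewrite free_lift1 coef_isup. Qed.

Lemma act_coact_comul A :
  tassoc _ (tmap (comul G) (linear_id _) (act_coact A)) =
  tmap (linear_id G) act_coact (act_coact A).
Proof.
move: A; apply: (@free_ext _ _ _
  (fun A => tassoc _ (tmap (comul G) (linear_id _) (act_coact A)))
  (fun A => tmap (linear_id G) act_coact (act_coact A))).
- exact: (linearP (linear_comp (tassoc _)
    (linear_comp (tmap (comul G) (linear_id _)) act_coact))).
- exact: (linearP (linear_comp (tmap (linear_id G) act_coact) act_coact)).
move=> a; rewrite free_lift1 !(linear_isup _ (linearP _)).
(* On a singleton both sides are this double supremum, up to the order of the indices. *)
transitivity (isup (fun x => isup (fun y => act a y ⊗ (act y x ⊗ [set x])))).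
  apply: eq_isup => x; rewrite tmap_pure act_comul.
  rewrite (linear_isup _ (pure_bilinear.1 _)) (linear_isup _ (linearP _)).
  by apply: eq_isup => y; rewrite tassoc_pure.
rewrite isup_exchange; apply: eq_isup => y.
rewrite [RHS]tmap_pure free_lift1 (linear_isup _ (pure_bilinear.2 _)).
exact: eq_isup.
Qed.

Lemma act_coact_counit A :
  tmap (counit G) (linear_id _) (act_coact A) = true ⊗ A.
Proof.
move: A; apply: (@free_ext _ _ _
  (fun A => tmap (counit G) (linear_id _) (act_coact A)) (pure true)).
- exact: (linearP (linear_comp (tmap (counit G) (linear_id _)) act_coact)).
- exact: pure_bilinear.2.
move=> a; apply: coef_inj => x; rewrite coef_tmap coef_act_coact.
rewrite act_counit coef_pure.
by have [->|ax] := pselect (a = x); [rewrite !asboolT|rewrite !asboolF//; exact/nesym].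
Qed.

Definition comodule_of_gset : comodule G :=
  Comodule act_coact_comul act_coact_counit.

End Coaction.

(** * The bijection on objects *)

(** The common carrier lets the coactions be compared without transport; the axioms are
    proof-irrelevant. *)
Lemma comodule_eq X (rho rho' : linear (set X) (tensor G (set X))) h1 h2 h1' h2' :
  rho = rho' -> @Comodule d G X rho h1 h2 = @Comodule d G X rho' h1' h2'.
Proof. by move=> rr'; subst rho'; congr Comodule; exact: Prop_irrelevance. Qed.

Lemma gset_of_comoduleK : cancel gset_of_comodule comodule_of_gset.
Proof.
case=> X rho rhoM rhoE; apply: comodule_eq.
apply/linear_eq/free_ext; [exact: linearP|exact: linearP|].
by move=> a; apply: coef_inj => b; rewrite coef_act_coact.
Qed.

Lemma gset_eq X (mu mu' : X -> X -> G) h1 h2 h3 h4 h1' h2' h3' h4' :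
  mu = mu' -> @GSet d G X mu h1 h2 h3 h4 = @GSet d G X mu' h1' h2' h3' h4'.
Proof. by move=> mumu'; subst mu'; congr GSet; exact: Prop_irrelevance. Qed.

Lemma comodule_of_gsetK : cancel comodule_of_gset gset_of_comodule.
Proof.
case=> X mu h1 h2 h3 h4; apply: gset_eq.
by apply/funext => a; apply/funext => b; exact: coef_act_coact.
Qed.

(** * Comodule morphisms and invariant relations *)

(** The stable subsets are exactly those underlying a subobject in [betaG G], by
    [underlying_stable_subobject] and [underlying_stable]. *)
Definition stable (X : gset G) (P : set X) :=
  forall a b, P a -> ~ P b -> act a b = \bot.

Definition stable_subobject (X : gset G) (P : set X) (PP : stable P) :
    @subobject (betaG G) X :=
  Subobject (mono_equiv_classP (MonoInto (@gsub_incl_mono _ _ _ _ PP))).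

Lemma underlying_stable_subobject (X : gset G) (P : set X) (PP : stable P) :
  underlying (stable_subobject PP) = P.
Proof.
have /underlyingE <- : stable_subobject PP (MonoInto (@gsub_incl_mono _ _ _ _ PP)).
  exact/mono_equiv_range.
apply/seteqP; split=> x; first by move=> [[z Pz] _ <-].
by move=> Px; exists (exist _ x Px).
Qed.

Lemma underlying_stable (X : gset G) (R : @subobject (betaG G) X) :
  stable (underlying R).
Proof.
have [m Rm] : exists m, R m.
  by have [m ->] := mono_classP R; exists m; exact/mono_equiv_range.
by move/underlyingE: Rm => <- a b; exact: range_stable.
Qed.

(** Both sides are linear, so it suffices to compare coefficients on singletons. The resulting
    equation says that the 0-1 matrix of [f] intertwines the two coaction matrices. *)
Lemma comodule_morP (M N : comodule G)
    (f : linear (set (comodule_set M)) (set (comodule_set N))) :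
  (forall A, coact N (f A) = tmap (linear_id G) f (coact M A)) <->
  (forall a y, ssup [set coact_matrix b y | b in f [set a]] =
               ssup [set coact_matrix a x | x in [set x | f [set x] y]]).
Proof.
have lhs a y : coef y (coact N (f [set a])) =
    ssup [set coact_matrix b y | b in f [set a]].
  by rewrite (set_ssup (f [set a])) !linearP !image_comp -set_ssup.
have rhs a y : coef y (tmap (linear_id G) f (coact M [set a])) =
    ssup [set coact_matrix a x | x in [set x | f [set x] y]].
  rewrite tmap_coef (linear_isup _ (linearP _)); apply/le_anti/andP; split.
    apply: isup_le => x; rewrite coef_pure.
    by case: asboolP => [fxy|_]; [apply: ssup_ub; exists x|exact: le0x].
  apply: ssup_le => _ [x fxy <-].
  apply: le_trans (isup_ub _ x); rewrite coef_pure asboolT//.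
split=> h; first by move=> a y; rewrite -lhs -rhs h.
apply: free_ext => [||a].
- exact: (linearP (linear_comp (coact N) f)).
- exact: (linearP (linear_comp (tmap (linear_id G) f) (coact M))).
- by apply: coef_inj => y; rewrite lhs rhs.
Qed.

Lemma stable_relP (X Y : gset G) (R : set (gprod X Y)) : stable R <->
  (forall a y, ssup [set act b y | b in [set b | R (a, b)]] =
               ssup [set act a x | x in [set x | R (x, y)]]).
Proof.
split=> [RP a y|h [a b] [x y] Rab Rxy].
  apply/le_anti/andP; split; apply: ssup_le => z.
    (* By (ed), [act b y] is the supremum of its meets with the [act a x]; stability kills the terms
       with [(x, y)] outside [R]. *)
    move=> [b Rab <-]; rewrite -[leLHS]meet1x -(lbij_ed (act_lbij X) a) ssup_meet.
    apply: ssup_le => _ [_ [x _ <-] <-].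
    have [Rxy|Rxy] := pselect (R (x, y)).
      by apply: le_trans (leIl _ _) _; apply: ssup_ub; exists x.
    by have := RP (a, b) (x, y) Rab Rxy; rewrite /= /gprod_act /= => ->; exact: le0x.
  (* Dually, (su) splits [act a x] along the [act b y]. Stability now runs from [(x, y)] to
     [(a, b)], hence the use of [act_sym_bot]. *)
  move=> [x Rxy <-]; rewrite -[leLHS]meetx1 -(lbij_su (act_lbij Y) y) meet_ssup.
  apply: ssup_le => _ [_ [b _ <-] <-].
  have [Rab|Rab] := pselect (R (a, b)).
    by apply: le_trans (leIr _ _) _; apply: ssup_ub; exists b.
  have := act_sym_bot (RP (x, y) (a, b) Rxy Rab).
  by rewrite /= /gprod_act /= => ->; exact: le0x.
(* By [h], [act b y] lies below the supremum of the [act a x'] with [x'] related to [y]. Such an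
   [x'] differs from [x], so (uv) makes each meet with [act a x] vanish. *)
apply/le_anti; rewrite le0x andbT.
have /(leI2 (lexx (act a x))) : act b y <= ssup [set act b y | b in [set b | R (a, b)]].
  by apply: ssup_ub; exists b.
move/le_trans; apply; rewrite h meet_ssup.
apply: ssup_le => _ [_ [x' Rx'y <-] <-].
rewrite (lbij_uv (act_lbij X))// => xx'; apply: Rxy.
by rewrite xx'.
Qed.

Lemma comodule_mor_stable (M N : comodule G) (f : comoduleMor M N) :
  @stable (gprod (gset_of_comodule M) (gset_of_comodule N)) (linear_rel f).
Proof. by apply/stable_relP; exact: (comodule_morP f).1 (@comoduleMorP _ _ _ _ f). Qed.

(** Since the matrix of [comodule_of_gset X] is [act], the criterion of [comodule_morP] becomes that
    of [stable_relP]. *)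
Lemma grel_comodule_mor (X Y : gset G) (R : Defs.grel X Y) A :
  coact (comodule_of_gset Y) (Linear (rel_image_linear (underlying R)) A) =
  tmap (linear_id G) (Linear (rel_image_linear (underlying R)))
    (coact (comodule_of_gset X) A).
Proof.
move: A; apply: (comodule_morP (M := comodule_of_gset X) (N := comodule_of_gset Y) _).2 => a y.
rewrite -[RHS](_ : ssup [set act a x | x in [set x | underlying R (x, y)]] = _).
  rewrite -((stable_relP (underlying R)).1 (@underlying_stable _ R)).
  rewrite -[in RHS](_ : rel_image (underlying R) [set a] = [set b | underlying R (a, b)]).
    by congr ssup; apply: eq_imagel => b _; exact: coef_act_coact.
  by apply/seteqP; split=> b; [move=> [_ ->]|exists a].
rewrite (_ : [set x | underlying R (x, y)] =
             [set x | rel_image (underlying R) [set x] y]).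
  by congr ssup; apply: eq_imagel => x _; exact/esym/coef_act_coact.
by apply/seteqP; split=> x; [exists x|move=> [_ ->]].
Qed.

(** * The two functors *)

Definition Cmd0_to_RelBetaG_hom (M N : comodule G) (f : comoduleMor M N) :
    Defs.grel (gset_of_comodule M) (gset_of_comodule N) :=
  stable_subobject (@comodule_mor_stable M N f).

Lemma Cmd0_to_RelBetaG_id (M : comodule G) :
  Cmd0_to_RelBetaG_hom (comodule_id M) = grel_id _.
Proof.
apply: underlying_inj; rewrite underlying_stable_subobject underlying_id.
exact: linear_rel_id.
Qed.

Lemma Cmd0_to_RelBetaG_comp (M N P : comodule G)
    (g : comoduleMor N P) (f : comoduleMor M N) :
  Cmd0_to_RelBetaG_hom (comodule_comp g f) =
  grel_comp (Cmd0_to_RelBetaG_hom g) (Cmd0_to_RelBetaG_hom f).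
Proof.
apply: underlying_inj; rewrite underlying_comp !underlying_stable_subobject.
exact: linear_rel_comp.
Qed.

Definition Cmd0_to_RelBetaG : functor (Cmd0 G) (RelBetaG G) :=
  @Functor (Cmd0 G) (RelBetaG G) gset_of_comodule Cmd0_to_RelBetaG_hom
    Cmd0_to_RelBetaG_id Cmd0_to_RelBetaG_comp.

Definition RelBetaG_to_Cmd0_hom (X Y : gset G) (R : Defs.grel X Y) :
    comoduleMor (comodule_of_gset X) (comodule_of_gset Y) :=
  @ComoduleMor _ _ (comodule_of_gset X) (comodule_of_gset Y)
    (Linear (rel_image_linear (underlying R))) (grel_comodule_mor R).

Lemma RelBetaG_to_Cmd0_id (X : gset G) :
  RelBetaG_to_Cmd0_hom (grel_id X) = comodule_id _.
Proof. by apply: comoduleMor_eq => /=; rewrite underlying_id rel_image_id. Qed.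

Lemma RelBetaG_to_Cmd0_comp (X Y Z : gset G) (S : Defs.grel Y Z) (R : Defs.grel X Y) :
  RelBetaG_to_Cmd0_hom (grel_comp S R) =
  comodule_comp (RelBetaG_to_Cmd0_hom S) (RelBetaG_to_Cmd0_hom R).
Proof. by apply: comoduleMor_eq => /=; rewrite underlying_comp rel_image_comp. Qed.

Definition RelBetaG_to_Cmd0 : functor (RelBetaG G) (Cmd0 G) :=
  @Functor (RelBetaG G) (Cmd0 G) comodule_of_gset RelBetaG_to_Cmd0_hom
    RelBetaG_to_Cmd0_id RelBetaG_to_Cmd0_comp.

Lemma Cmd0_to_RelBetaG_forget :
  functor_comp ell (functor_comp (RelBetaG_forget G) Cmd0_to_RelBetaG) =
  Cmd0_forget G.
Proof.
apply: functor_eq_ob => M N f /=.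
by rewrite underlying_stable_subobject; exact: linear_relK.
Qed.

Lemma RelBetaG_to_Cmd0_forget :
  functor_comp (Cmd0_forget G) RelBetaG_to_Cmd0 =
  functor_comp ell (RelBetaG_forget G).
Proof. exact: functor_eq_ob. Qed.

End ComodulesAndActions.

(** * Equality of functors through a faithful functor *)

Definition faithful (C D : category) (F : functor C D) :=
  forall a b : C, injective (@fhom C D F a b).

(** Equality of the records gives an equality of dependent pairs over [F]; proof irrelevance makes
    its first component [erefl], so the transport disappears. *)
Lemma fhom_inj (C D : category) (F : C -> D) fh1 fh2 i1 i2 c1 c2 :
  @Functor C D F fh1 i1 c1 = @Functor C D F fh2 i2 c2 -> fh1 = fh2.
Proof.
pose hom_over (F' : C -> D) := forall a b : C, hom a b -> hom (F' a) (F' b).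
move=> /(congr1 (fun H : functor C D => existT hom_over (fob H) (@fhom C D H))) /= e.
have e2 := projT2_eq e; move: (projT1_eq e) e2 => /= e1.
by rewrite (Prop_irrelevance e1 erefl).
Qed.

(** Handles object maps that agree only propositionally: the arrows are compared after applying [U],
    so no transport of arrows has to be computed. *)
Lemma faithful_functor_eq (C D E : category) (U : functor D E)
    (F1 F2 : functor C D) : faithful U -> fob F1 =1 fob F2 ->
  functor_comp U F1 = functor_comp U F2 -> F1 = F2.
Proof.
move=> Uf; case: F1 F2 => [F1 fh1 i1 c1] [F2 fh2 i2 c2] /= /funext F12; subst F2.
move=> /fhom_inj fhE; apply: functor_eq_ob => a b f; apply: Uf.
exact: (f_equal (fun fh => fh a b f) fhE).
Qed.

Lemma functor_compA (C D E E' : category) (H : functor E E') (G : functor D E)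
    (F : functor C D) :
  functor_comp H (functor_comp G F) = functor_comp (functor_comp H G) F.
Proof. exact: functor_eq_ob. Qed.

Lemma functor_comp1 (C D : category) (F : functor C D) :
  functor_comp F (functor_id C) = F.
Proof. by case: F => *; exact: functor_eq_ob. Qed.

Lemma Cmd0_forget_faithful d (G : localicGroup d) : faithful (Cmd0_forget G).
Proof. by move=> M N f g; exact: comoduleMor_eq. Qed.

Lemma ell_RelBetaG_forget_faithful d (G : localicGroup d) :
  faithful (functor_comp ell (RelBetaG_forget G)).
Proof.
move=> X Y R S /(can_inj (@rel_imageK _ _)) RS.
exact: (@underlying_inj _ _ (gprod X Y) R S RS).
Qed.

Theorem theorem4p6 (d : Order.disp_t) (G : localicGroup d) :
  exists Phi : functor (Cmd0 G) (RelBetaG G),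
    isomorphism_of_categories Phi /\
    functor_comp ell (functor_comp (RelBetaG_forget G) Phi) = Cmd0_forget G.
Proof.
exists (Cmd0_to_RelBetaG G); split; last exact: Cmd0_to_RelBetaG_forget.
exists (RelBetaG_to_Cmd0 G); split.
  apply: (faithful_functor_eq (@Cmd0_forget_faithful _ G)).
    exact: gset_of_comoduleK.
  (* The two compatibilities with the forgetful functors absorb [RelBetaG_to_Cmd0] and then
     [Cmd0_to_RelBetaG], leaving [Cmd0_forget G]. *)
  rewrite functor_compA RelBetaG_to_Cmd0_forget -functor_compA.
  by rewrite Cmd0_to_RelBetaG_forget functor_comp1.
apply: (faithful_functor_eq (@ell_RelBetaG_forget_faithful _ G)).
  exact: comodule_of_gsetK.
rewrite functor_compA -(functor_compA ell).
by rewrite Cmd0_to_RelBetaG_forget RelBetaG_to_Cmd0_forget functor_comp1.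
Qed.
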